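(* Let $M$ be a $(2n+1)$-dimensional smooth manifold with a Legendrean contact structure $H=E\oplus F\subset TM$ and let $Q=TM/H$. The first relative BGG operator $D=\nabla^{TM/F}\circ S$, which maps sections of $Q$ to sections of $F^*\otimes F^*\otimes Q$, has values in the subbundle $\operatorname{Sym}^2(F^* )\otimes Q$ of $F^*\otimes F^*\otimes Q$. Moreover, for any contact form $\theta\in\Omega^1(M)$ and any $\rho\in\Gamma(Q)$, $$D(\rho)=\nabla^{E}\nabla^{Q}\rho+\theta(\rho)\,\mathrm{P},$$ where $\mathrm{P}\in\Gamma(F^*\otimes E)\cong\Gamma(F^*\otimes F^*\otimes Q)$ is given by $\mathrm{P}(\xi)=[\xi,r]_E$ for $\xi\in\Gamma(F)$, with $r$ the Reeb vector field of $\theta$.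
   Context: A contact structure on a smooth $(2n+1)$-manifold $M$ is a corank-one subbundle $H\subset TM$ such that, with $Q:=TM/H$ and projection $\pi_Q:TM\to Q$, the Levi bracket $\mathcal{L}:\Lambda^2H\to Q$, $\mathcal{L}(\eta,\xi)=\pi_Q([\eta,\xi])$ for $\eta,\xi\in\Gamma(H)$, is nondegenerate. A Legendrean contact structure is a splitting $H=E\oplus F$ into two rank-$n$ subbundles with $\mathcal{L}|_{E\times E}=0$ and $\mathcal{L}|_{F\times F}=0$ (no involutivity of $E$ or $F$ is assumed). A lower index $E$ or $F$ on a section of $H$ denotes its component in $E$ or $F$. A contact form is $\theta\in\Omega^1(M)$ with $\ker\theta=H$ (contact forms are assumed to exist); it descends to $Q$, so $\theta(\rho)$ makes sense for $\rho\in\Gamma(Q)$. Convention: $d\theta(X,Y)=X\cdot\theta(Y)-Y\cdot\theta(X)-\theta([X,Y])$. The Reeb vector field $r$ of $\theta$ is the unique vector field with $\theta(r)=1$, $\iota_r d\theta=0$; for $\xi\in\Gamma(H)$ one has $[\xi,r]\in\Gamma(H)$. The contact form induces an isomorphism $\Gamma(TM/F)\to\Gamma(Q\oplus E)$, $t+F\mapsto (t)_\theta:=\big(\pi_Q(t),(t-\theta(t)r)_E\big)^{\intercal}$ for $t\in\Gamma(TM)$. A partial connection on a vector bundle $V$ in $F$-directions is a map $\Gamma(F)\times\Gamma(V)\to\Gamma(V)$ that is $\mathscr{C}^\infty(M)$-linear in the first argument and satisfies the Leibniz rule in the second. Given $\theta$, partial connections are defined by $\nabla^Q_\xi\rho=(\xi\cdot\theta(\rho))\pi_Q(r)$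 on $Q$ and $\nabla^E_\xi\eta=([\xi,\eta]-\theta([\xi,\eta])r)_E$ on $E$ (equivalently $d\theta(\nabla^E_{\xi}\eta,\xi')=d\theta([\xi,\eta],\xi')$ for all $\xi'\in\Gamma(F)$). The partial connection $\nabla^{TM/F}$ on $TM/F$ in $F$-directions is given, in the splitting $(t)_\theta=(\rho,\mu)^{\intercal}$ determined by a contact form $\theta$, by $$(\nabla^{TM/F}_\xi t)_\theta=\big(\nabla^Q_\xi\rho+\mathcal{L}(\xi,\mu),\ \nabla^E_\xi\mu+\theta(\rho)[\xi,r]_E\big)^{\intercal}.$$ Identification: $E\cong F^*\otimes Q$ via $\eta\mapsto\mathcal{L}(\eta,\cdot)|_F$. Under it, $\nabla^Q\rho\in\Gamma(F^*\otimes Q)$ is viewed as the section $\mu\in\Gamma(E)$ with $\mathcal{L}(\mu,\xi)=\nabla^Q_\xi\rho$ for all $\xi\in\Gamma(F)$; thus $\nabla^E\nabla^Q\rho\in\Gamma(F^*\otimes E)$ makes sense, and $F^*\otimes E\cong F^*\otimes F^*\otimes Q$ sends $\phi$ to $(\xi_1,\xi_2)\mapsto\mathcal{L}(\phi(\xi_1),\xi_2)$. Let $\partial^*:F^*\otimes TM/F\to TM/F$ be the composition $F^*\otimes TM/F\xrightarrow{\mathrm{id}\otimes\pi_Q}F^*\otimes Q\cong E\hookrightarrow TM/F$. The operator $S:\Gamma(Q)\to\Gamma(TM/F)$ assigns to $\rho$ the unique section $S(\rho)$ with $\pi_Q(S(\rho))=\rho$ and $\partial^*\nabla^{TM/F}S(\rho)=0$;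 in the splitting given by $\theta$, $(S(\rho))_\theta=(\rho,\nabla^Q\rho)^{\intercal}$. By the defining condition, $\nabla^{TM/F}S(\rho)$ is a section of $F^*\otimes E\subset F^*\otimes TM/F$, and $D(\rho):=\nabla^{TM/F}S(\rho)$ is regarded as a section of $F^*\otimes F^*\otimes Q$ via the identification above.
   Formalization: The partial connection on TM/F is assumed to have the displayed expression for every contact form at once, which forces F to be involutive; for non-involutive F it would depend on the contact form and D would not take values in Sym^2(F* ) ⊗ Q. *)

(* Defs.v *)
From mathcomp Require Import all_boot all_order all_algebra.
From mathcomp Require Import all_classical all_reals all_analysis.

Set Implicit Arguments.
Unset Strict Implicit.
Unset Printing Implicit Defensive.

Import Order.TTheory GRing.Theory Num.Theory.
Import numFieldNormedType.Exports.
Local Open Scope classical_set_scope.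
Local Open Scope ring_scope.

(* [Ck k U f]: f is k times continuously differentiable (in the sense of
   partial derivatives) on U; only used for open sets U. *)
Fixpoint Ck (R : realType) (m k : nat) (U : set 'rV[R]_m) (f : 'rV[R]_m -> R)
    {struct k} : Prop :=
  (forall x, U x -> {for x, continuous f}) /\
  match k with
  | 0 => True
  | k'.+1 => forall i : 'I_m,
      (forall x, U x -> derivable f x (delta_mx 0 i)) /\
      Ck k' U (fun x => 'D_(delta_mx 0 i) f x)
  end.

(* A chart of T; [chart_map] and [chart_inv] are only meaningful on
   [chart_dom] and [chart_cod] respectively. *)
Record chart (R : realType) (m : nat) (T : topologicalType) := Chart {
  chart_dom : set T;
  chart_cod : set 'rV[R]_m;
  chart_map : T -> 'rV[R]_m;
  chart_inv : 'rV[R]_m -> T }.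

Definition is_chart (R : realType) (m : nat) (T : topologicalType)
    (c : chart R m T) : Prop :=
  [/\ open (chart_dom c) /\ open (chart_cod c),
      forall p, chart_dom c p ->
        chart_cod c (chart_map c p) /\ chart_inv c (chart_map c p) = p,
      forall x, chart_cod c x ->
        chart_dom c (chart_inv c x) /\ chart_map c (chart_inv c x) = x,
      forall p, chart_dom c p -> {for p, continuous (chart_map c)} &
      forall x, chart_cod c x -> {for x, continuous (chart_inv c)}].

Record manifold (R : realType) (m : nat) := Manifold {
  carrier :> topologicalType;
  atlas : set (chart R m carrier);
  manifold_hausdorff : hausdorff_space carrier;
  manifold_second_countable : @second_countable carrier;
  atlas_chart : forall c, atlas c -> is_chart c;
  atlas_cover : forall p : carrier, exists2 c, atlas c & chart_dom c p;
  atlas_smooth : forall c c', atlas c -> atlas c' ->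
    forall (k : nat) (j : 'I_m),
      Ck k [set x | chart_cod c x /\ chart_dom c' (chart_inv c x)]
           (fun x => chart_map c' (chart_inv c x) 0 j) }.

Section Calculus.
Variables (R : realType) (m : nat) (M : manifold R m).

Definition smooth_on (U : set M) (f : M -> R) : Prop :=
  forall c, atlas c -> forall k,
    Ck k [set x | chart_cod c x /\ U (chart_inv c x)] (f \o chart_inv c).

Definition smooth (f : M -> R) : Prop := smooth_on setT f.

Definition smooth_near (p : M) (f : M -> R) : Prop :=
  exists2 U : set M, open_nbhs p U & smooth_on U f.

(* Tangent vectors at p are the derivations of the algebra of germs at p of
   smooth functions.  They are represented as functionals on all functions
   M -> R: the last two clauses say that they factor through germs and take
   the value 0 on functions that are not smooth near p, so that equality of
   tangent vectors is equality of functionals. *)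
Definition vec : Type := (M -> R) -> R.

Definition tangent (p : M) : set vec := [set v : vec |
  [/\ forall f g, smooth_near p f -> smooth_near p g ->
        v (fun q => f q + g q) = v f + v g,
      forall (a : R) f, smooth_near p f -> v (fun q => a * f q) = a * v f,
      forall f g, smooth_near p f -> smooth_near p g ->
        v (fun q => f q * g q) = v f * g p + f p * v g,
      forall f g, (\forall q \near p, f q = g q) -> v f = v g &
      forall f, ~ smooth_near p f -> v f = 0] ].

Definition vzero : vec := fun _ => 0.
Definition vadd (v w : vec) : vec := fun f => v f + w f.
Definition vsub (v w : vec) : vec := fun f => v f - w f.
Definition vscale (a : R) (v : vec) : vec := fun f => a * v f.
Definition vlin (k : nat) (c : 'I_k -> R) (v : 'I_k -> vec) : vec :=
  fun f => \sum_(i < k) c i * v i f.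

(* Vector fields and 1-forms are smooth only under [vector_field] and
   [one_form] below. *)
Definition rough_field : Type := M -> vec.

Definition act (X : rough_field) (f : M -> R) : M -> R := fun p => X p f.

Definition vector_field (X : rough_field) : Prop :=
  (forall p, tangent p (X p)) /\
  (forall p f, smooth_near p f -> smooth_near p (act X f)).

Definition fadd (X Y : rough_field) : rough_field := fun p => vadd (X p) (Y p).
Definition fsub (X Y : rough_field) : rough_field := fun p => vsub (X p) (Y p).
Definition fscale (f : M -> R) (X : rough_field) : rough_field :=
  fun p => vscale (f p) (X p).

Definition bracket (X Y : rough_field) : rough_field := fun p f =>
  if `[< smooth_near p f >] then X p (act Y f) - Y p (act X f) else 0.

Definition dist : Type := M -> set vec.

Definition section (K : dist) (X : rough_field) : Prop :=
  vector_field X /\ forall p, K p (X p).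

(* Subbundle of TM of rank k.  The local frame is taken to consist of global
   sections that are a frame near p: multiplying a local frame by a cutoff
   function that is 1 near p shows that this is no restriction. *)
Definition subbundle (k : nat) (K : dist) : Prop :=
  forall p : M, exists X : 'I_k -> rough_field,
    (forall i, section K (X i)) /\
    (\forall q \near p,
       (forall v, K q v <-> exists c, v = vlin c (X ^~ q)) /\
       (forall c, vlin c (X ^~ q) = vzero -> forall i, c i = 0)).

(* TM/K has rank one: near every point it is spanned by the class of a vector
   field that is not in K there. *)
Definition corank_one (K : dist) : Prop :=
  forall p : M, exists Z : rough_field,
    vector_field Z /\
    (\forall q \near p, ~ K q (Z q) /\
       forall v, tangent q v -> exists c, K q (vsub v (vscale c (Z q)))).

(* A section of TM/K is a function sending p to a coset of K p in the tangent
   space at p; [coset K X] is the class X + K.  The operations on sections of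
   TM/K are computed on representatives. *)
Definition qfield : Type := M -> set vec.

Definition coset (K : dist) (X : rough_field) : qfield :=
  fun p => [set v | K p (vsub (X p) v)].

Definition qsection (K : dist) (t : qfield) : Prop :=
  exists2 X, vector_field X & t = coset K X.

Definition rep (t : qfield) : rough_field := fun p => xget vzero (t p).

Definition qzero (K : dist) : qfield := coset K (fun _ => vzero).
Definition qadd (K : dist) (s t : qfield) : qfield :=
  coset K (fadd (rep s) (rep t)).
Definition qscale (K : dist) (f : M -> R) (t : qfield) : qfield :=
  coset K (fscale f (rep t)).

Definition partial_connection (F K : dist)
    (nab : rough_field -> qfield -> qfield) : Prop :=
  [/\ forall xi t, section F xi -> qsection K t -> qsection K (nab xi t),
      forall xi xi' t, section F xi -> section F xi' -> qsection K t ->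
        nab (fadd xi xi') t = qadd K (nab xi t) (nab xi' t),
      forall f xi t, smooth f -> section F xi -> qsection K t ->
        nab (fscale f xi) t = qscale K f (nab xi t),
      forall xi s t, section F xi -> qsection K s -> qsection K t ->
        nab xi (qadd K s t) = qadd K (nab xi s) (nab xi t) &
      forall f xi t, smooth f -> section F xi -> qsection K t ->
        nab xi (qscale K f t) =
          qadd K (qscale K (act xi f) t) (qscale K f (nab xi t))].

Definition rough_form : Type := M -> vec -> R.

Definition ev (theta : rough_form) (X : rough_field) : M -> R :=
  fun p => theta p (X p).

Definition one_form (theta : rough_form) : Prop :=
  [/\ forall p v w, tangent p v -> tangent p w ->
        theta p (vadd v w) = theta p v + theta p w,
      forall p a v, tangent p v -> theta p (vscale a v) = a * theta p v &
      forall X, vector_field X -> smooth (ev theta X)].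

Definition ext_d (theta : rough_form) (X Y : rough_field) : M -> R := fun p =>
  act X (ev theta Y) p - act Y (ev theta X) p - theta p (bracket X Y p).

End Calculus.

Section Contact.
Variables (R : realType) (n : nat) (M : manifold R n.*2.+1).
Variables (H E F : dist M).
Implicit Types (theta : rough_form M) (X Y eta xi mu : rough_field M).
Implicit Types (t rho : qfield M).

Definition levi eta xi : qfield M := coset H (bracket eta xi).

(* Every vector of H p is the value of a section of H, so the last clause is
   nondegeneracy of the bilinear form induced by the Levi bracket on H p. *)
Definition contact_structure : Prop :=
  [/\ subbundle n.*2 H, corank_one H &
      forall p eta, section H eta ->
        (forall xi, section H xi -> levi eta xi p = qzero H p) ->
        eta p = @vzero _ _ M].

Definition legendrean_contact_structure : Prop :=
  [/\ contact_structure,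
      subbundle n E /\ subbundle n F,
      (forall p v, H p v <-> exists e f, [/\ E p e, F p f & v = vadd e f]) /\
      (forall p v, E p v -> F p v -> v = @vzero _ _ M),
      forall eta eta', section E eta -> section E eta' ->
        levi eta eta' = qzero H &
      forall xi xi', section F xi -> section F xi' -> levi xi xi' = qzero H].

(* The component in E of a section of H = E (+) F. *)
Definition Ecomp X : rough_field M := fun p =>
  xget (@vzero _ _ M) [set e | E p e /\ F p (vsub (X p) e)].

Definition contact_form theta : Prop :=
  one_form theta /\ forall p v, tangent p v -> (theta p v = 0 <-> H p v).

Definition reeb theta : rough_field M :=
  xget (fun _ => @vzero _ _ M) [set r |
    [/\ vector_field r, forall p, theta p (r p) = 1 &
        forall Y, vector_field Y -> forall p, ext_d theta r Y p = 0] ].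

(* theta(rho) for a section rho of Q *)
Definition qev theta rho : M -> R := ev theta (rep rho).

(* The projection TM/F -> TM/H *)
Definition piQ t : qfield M := coset H (rep t).

Definition horizontal theta X : rough_field M :=
  fsub X (fscale (ev theta X) (reeb theta)).

(* The splitting of TM/F as the sum of Q and E determined by theta *)
Definition split theta t : qfield M * rough_field M :=
  (piQ t, Ecomp (horizontal theta (rep t))).

Definition nablaQ theta xi rho : qfield M :=
  qscale H (act xi (qev theta rho)) (coset H (reeb theta)).

Definition nablaE theta xi eta : rough_field M :=
  Ecomp (horizontal theta (bracket xi eta)).

(* The partial connection on TM/F does not depend on a contact form: one and
   the same operator has the expression below in the splitting determined by
   any contact form theta. *)
Definition is_nablaTMF (nab : rough_field M -> qfield M -> qfield M) : Prop :=
  partial_connection F F nab /\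
  forall theta, contact_form theta ->
  forall xi t, section F xi -> qsection F t ->
    let rho := (split theta t).1 in
    let mu := (split theta t).2 in
    split theta (nab xi t) =
      (qadd H (nablaQ theta xi rho) (levi xi mu),
       fadd (nablaE theta xi mu)
            (fscale (qev theta rho) (Ecomp (bracket xi (reeb theta))))).

(* The section of E corresponding to a section psi of F^* (x) Q (given as an
   operator on sections of F) under eta |-> L(eta, .)|_F. *)
Definition sharp (psi : rough_field M -> qfield M) : rough_field M :=
  xget (fun _ => @vzero _ _ M) [set e | section E e /\
    forall xi, section F xi -> levi e xi = psi xi].

Definition del_star (phi : rough_field M -> qfield M) : qfield M :=
  coset F (sharp (fun xi => piQ (phi xi))).

Definition BGG_S (nab : rough_field M -> qfield M -> qfield M) rho : qfield M :=
  xget (qzero F) [set s |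
    [/\ qsection F s, piQ s = rho & del_star (nab ^~ s) = qzero F] ].

(* F^* (x) E ~ F^* (x) F^* (x) Q *)
Definition flat (phi : rough_field M -> rough_field M)
    (xi1 xi2 : rough_field M) : qfield M :=
  levi (phi xi1) xi2.

(* The section of E whose class is t, for t in the image of E in TM/F *)
Definition Elift t : rough_field M :=
  xget (fun _ => @vzero _ _ M) [set e | section E e /\ t = coset F e].

Definition BGG_D (nab : rough_field M -> qfield M -> qfield M) rho :
    rough_field M -> rough_field M -> qfield M :=
  flat (fun xi => Elift (nab xi (BGG_S nab rho))).

(* Sections of F^* (x) F^* (x) Q, resp. Sym^2(F^* ) (x) Q, as bilinear
   operators over the smooth functions *)
Definition FFQ_section (B : rough_field M -> rough_field M -> qfield M) : Prop :=
  [/\ forall xi1 xi2, section F xi1 -> section F xi2 ->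
        qsection H (B xi1 xi2),
      forall xi1 xi1' xi2, section F xi1 -> section F xi1' -> section F xi2 ->
        B (fadd xi1 xi1') xi2 = qadd H (B xi1 xi2) (B xi1' xi2),
      forall xi1 xi2 xi2', section F xi1 -> section F xi2 -> section F xi2' ->
        B xi1 (fadd xi2 xi2') = qadd H (B xi1 xi2) (B xi1 xi2'),
      forall f xi1 xi2, smooth f -> section F xi1 -> section F xi2 ->
        B (fscale f xi1) xi2 = qscale H f (B xi1 xi2) &
      forall f xi1 xi2, smooth f -> section F xi1 -> section F xi2 ->
        B xi1 (fscale f xi2) = qscale H f (B xi1 xi2)].

Definition Sym2FQ_section (B : rough_field M -> rough_field M -> qfield M) : Prop :=
  FFQ_section B /\
  forall xi1 xi2, section F xi1 -> section F xi2 -> B xi1 xi2 = B xi2 xi1.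

(* nabla^E nabla^Q rho, a section of F^* (x) E *)
Definition nablaE_nablaQ theta rho (xi : rough_field M) : rough_field M :=
  nablaE theta xi (sharp (fun xi' => nablaQ theta xi' rho)).

Definition Ptensor theta (xi : rough_field M) : rough_field M :=
  Ecomp (bracket xi (reeb theta)).

End Contact.

(* Main.v *)
Require Import Defs.
From mathcomp Require Import all_boot all_order all_algebra.
From mathcomp Require Import all_classical all_reals all_analysis.
From mathcomp Require Import ring.

Set Implicit Arguments.
Unset Strict Implicit.
Unset Printing Implicit Defensive.

Import Order.TTheory GRing.Theory Num.Theory.
Import numFieldNormedType.Exports.
Local Open Scope classical_set_scope.
Local Open Scope ring_scope.

(* Write [g = theta(rho)], [mu] for the section of E corresponding to
   [nabla^Q rho], r for the Reeb field and [omega = d theta].  Then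
   [S(rho) = g r + mu] modulo F, and [D(rho)(xi)] is the section
   [Phi(xi) = nabla^E_xi mu + g [xi, r]_E] of E, which is the formula for D.

   From [d omega = 0] evaluated on [(xi1, xi2, mu)] and [(xi1, xi2, r)], the
   skew part of [D(rho)(xi1, xi2)] is [[xi1, xi2]_E . g], up to [pi_Q(r)].  It
   does not vanish for formal reasons, since F is not assumed involutive; the
   invariance of the partial connection on TM/F forces it to vanish.  Indeed,
   for [rho = pi_Q(r)] we have g = 1 and the skew part is 0; computed with the
   contact form [h theta] for the same rho it is [[xi1, xi2]_E . h].  So
   [[xi1, xi2]_E] annihilates every nowhere vanishing smooth function h, and
   [h = 1 + (g - g(p) + 1)^2], whose differential at p is [2 dg], gives the
   claim for g at p. *)

(** * Functions of class C^k *)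

(** The obstacle is regularity. [ext_d] takes global vector fields, whereas the argument needs a
    bilinear form on each tangent space; and the Reeb field, the section mu and the projection of H
    to E are all prescribed pointwise by linear conditions, so their smoothness has to be proved. No
    coordinate vector fields are used for this. A frame W that is independent at p is separated
    there by finitely many functions x_j, in the sense that the determinant of the matrix (W_i(x_j))
    is nonzero at p, so by Cramer's rule the coefficients of a field in W are smooth near p. A
    condition that has exactly one solution at each point then glues its local smooth solutions
    without a partition of unity. The function h in the last step must vanish nowhere because h
    theta has to be a contact form again; this is why g itself cannot be used as the rescaling
    factor. *)

Section CkTheory.
Variables (R : realType) (m : nat).
Implicit Types (U : set 'rV[R]_m) (f g : 'rV[R]_m -> R) (k : nat).

Lemma Ck_eq k U f g : open U -> (forall x, U x -> f x = g x) ->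
  Ck k U f -> Ck k U g.
Proof.
move=> oU; elim: k f g => [|k IH] f g fg.
  case=> fc _; split => // x Ux.
  have nfg : {near x, f =1 g}.
    by apply: filterS fg _; exact: open_nbhs_nbhs.
  rewrite /prop_for /continuous_at -(fg _ Ux).
  exact: cvg_trans (near_eq_cvg nfg) (fc x Ux).
case=> fc fD.
have nfg x : U x -> {near x, f =1 g}.
  by move=> Ux; apply: filterS fg _; exact: open_nbhs_nbhs.
split=> [x Ux|i].
  rewrite /prop_for /continuous_at -(fg _ Ux).
  exact: cvg_trans (near_eq_cvg (nfg x Ux)) (fc x Ux).
have [fd fC] := fD i; split=> [x Ux|].
  exact: near_eq_derivable (nfg x Ux) (fd x Ux).
by apply: IH fC => x Ux; exact: near_eq_derive (nfg x Ux).
Qed.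

Lemma Ck_sub k U V f : V `<=` U -> Ck k U f -> Ck k V f.
Proof.
move=> VU; elim: k f => [|k IH] f [fc fD]; split=> [x /VU/fc //|] => // i.
by have [fd fC] := fD i; split=> [x /VU/fd //|]; exact: IH.
Qed.

(** The Leibniz rule multiplies a first derivative of one factor by the other factor itself;
    lowering the order of the latter lets the induction on k apply to both. *)
Lemma CkW k U f : Ck k.+1 U f -> Ck k U f.
Proof.
elim: k f => [|k IH] f [fc fD]; split=> // i.
by have [fd fC] := fD i; split=> //; exact: IH.
Qed.

Lemma Ck_cst k U (a : R) : Ck k U (fun=> a).
Proof.
elim: k a => [|k IH] a; split=> [x _|] //; try exact: cst_continuous.
move=> i; split=> [x _|]; first exact: derivable_cst.
suff -> : (fun x : 'rV[R]_m => 'D_(delta_mx 0 i) (fun=> a) x) = (fun=> 0 : R) by [].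
by apply/funext => x; exact: derive_cst.
Qed.

Lemma CkD k U f g : open U -> Ck k U f -> Ck k U g -> Ck k U (fun x => f x + g x).
Proof.
move=> oU; elim: k f g => [|k IH] f g [fc fD] [gc gD].
  by split=> // x Ux; apply: continuousD; [exact: fc|exact: gc].
split=> [x Ux|i]; first by apply: continuousD; [exact: fc|exact: gc].
have [fd fC] := fD i; have [gd gC] := gD i.
split=> [x Ux|]; first by apply: derivableD; [exact: fd|exact: gd].
apply: Ck_eq (IH _ _ fC gC) => // x Ux.
by rewrite -deriveD //; [exact: fd|exact: gd].
Qed.

Lemma CkM k U f g : open U -> Ck k U f -> Ck k U g -> Ck k U (fun x => f x * g x).
Proof.
move=> oU; elim: k f g => [|k IH] f g Cf Cg; have [fc fD] := Cf; have [gc gD] := Cg.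
  by split=> // x Ux; apply: continuousM; [exact: fc|exact: gc].
split=> [x Ux|i]; first by apply: continuousM; [exact: fc|exact: gc].
have [fd fC] := fD i; have [gd gC] := gD i.
split=> [x Ux|]; first by apply: derivableM; [exact: fd|exact: gd].
apply: Ck_eq (CkD oU (IH _ _ (CkW Cf) gC) (IH _ _ (CkW Cg) fC)) => // x Ux.
by rewrite [RHS](deriveM (fd x Ux) (gd x Ux)).
Qed.

Lemma CkV k U f : open U -> (forall x, U x -> f x != 0) -> Ck k U f ->
  Ck k U (fun x => (f x)^-1).
Proof.
move=> oU f0; elim: k => [|k IH] Cf; have [fc fD] := Cf.
  by split=> // x Ux; apply: continuousV; [exact: f0|exact: fc].
split=> [x Ux|i]; first by apply: continuousV; [exact: f0|exact: fc].
have [fd fC] := fD i.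
split=> [x Ux|]; first by apply: derivableV; [exact: f0|exact: fd].
have IHf := IH (CkW Cf).
apply: Ck_eq (CkM oU (Ck_cst k U (-1)) (CkM oU (CkM oU IHf IHf) fC)) => // x Ux.
rewrite (deriveV (f0 _ Ux) (fd _ Ux)) scaleNr mulN1r /GRing.scale /=.
by rewrite -exprVn expr2.
Qed.

End CkTheory.

(** * Smooth functions on a manifold *)

Lemma near_openP (T : topologicalType) (p : T) (P : T -> Prop) :
  (\forall q \near p, P q) <-> exists2 V, open_nbhs p V & V `<=` P.
Proof. by rewrite -[X in X <-> _]/(nbhs p P) nbhsE; split=> -[V]; exists V. Qed.

Section SmoothFunctions.
Variables (R : realType) (m : nat) (M : manifold R m).
Implicit Types (U : set M) (f g : M -> R) (p q : M).

Lemma open_chart_preimage (c : chart R m M) U : atlas c -> open U ->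
  open [set x | chart_cod c x /\ U (chart_inv c x)].
Proof.
move=> /atlas_chart[[_ oc] _ _ _ ci] oU; rewrite openE => x [cx Ux].
apply: filterI; first exact: open_nbhs_nbhs.
by apply: (ci x cx); exact: open_nbhs_nbhs.
Qed.

Lemma smooth_on_eq U f g : open U -> (forall q, U q -> f q = g q) ->
  smooth_on U f -> smooth_on U g.
Proof.
move=> oU fg sf c ac k; apply: Ck_eq (sf c ac k).
  exact: open_chart_preimage.
by move=> x [_ Ux]; exact: fg.
Qed.

Lemma smooth_on_sub U V f : V `<=` U -> smooth_on U f -> smooth_on V f.
Proof.
by move=> VU sf c ac k; apply: Ck_sub (sf c ac k) => x [cx /VU Ux].
Qed.

Lemma smooth_on_cst U (a : R) : smooth_on U (fun=> a).
Proof. by move=> c ac k; exact: Ck_cst. Qed.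

Lemma smooth_onD U f g : open U -> smooth_on U f -> smooth_on U g ->
  smooth_on U (fun q => f q + g q).
Proof.
by move=> oU sf sg c ac k; apply: CkD (sf c ac k) (sg c ac k);
  exact: open_chart_preimage.
Qed.

Lemma smooth_onM U f g : open U -> smooth_on U f -> smooth_on U g ->
  smooth_on U (fun q => f q * g q).
Proof.
by move=> oU sf sg c ac k; apply: CkM (sf c ac k) (sg c ac k);
  exact: open_chart_preimage.
Qed.

Lemma smooth_onV U f : open U -> (forall q, U q -> f q != 0) ->
  smooth_on U f -> smooth_on U (fun q => (f q)^-1).
Proof.
move=> oU f0 sf c ac k; apply: (CkV _ _ (sf c ac k)).
  exact: open_chart_preimage.
by move=> x [_ Ux]; exact: f0.
Qed.

Lemma smoothP f p : smooth f -> smooth_near p f.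
Proof. by move=> sf; exists setT => //; split=> //; exact: openT. Qed.

Lemma smooth_near_germ p f g : (\forall q \near p, f q = g q) ->
  smooth_near p f -> smooth_near p g.
Proof.
move=> /near_openP[V [oV Vp] fg] [U [oU Up] sf].
have oUV : open (U `&` V) by exact: openI.
exists (U `&` V); first by split.
apply: (smooth_on_eq (f := f)) => //; first by move=> q [_ /fg].
by apply: smooth_on_sub sf => q [].
Qed.

Lemma smooth_near_near p f : smooth_near p f ->
  \forall q \near p, smooth_near q f.
Proof.
case=> U [oU Up] sf; apply/near_openP; exists U; first by split.
by move=> q Uq; exists U.
Qed.

Lemma smooth_near_cst p (a : R) : smooth_near p (fun=> a).
Proof. by apply: smoothP; exact: smooth_on_cst. Qed.

Lemma smooth_near2 p f g : smooth_near p f -> smooth_near p g ->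
  exists U, [/\ open U, U p, smooth_on U f & smooth_on U g].
Proof.
move=> [U [oU Up] sf] [V [oV Vp] sg]; exists (U `&` V).
by split=> //; [exact: openI|apply: smooth_on_sub sf|apply: smooth_on_sub sg] => q [].
Qed.

Lemma smooth_nearD p f g : smooth_near p f -> smooth_near p g ->
  smooth_near p (fun q => f q + g q).
Proof.
move=> sf sg; have [U [oU Up fU gU]] := smooth_near2 sf sg.
by exists U => //; exact: smooth_onD.
Qed.

Lemma smooth_nearM p f g : smooth_near p f -> smooth_near p g ->
  smooth_near p (fun q => f q * g q).
Proof.
move=> sf sg; have [U [oU Up fU gU]] := smooth_near2 sf sg.
by exists U => //; exact: smooth_onM.
Qed.

Lemma smooth_nearZ p (a : R) f : smooth_near p f ->
  smooth_near p (fun q => a * f q).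
Proof. by apply: smooth_nearM; exact: smooth_near_cst. Qed.

Lemma smooth_nearB p f g : smooth_near p f -> smooth_near p g ->
  smooth_near p (fun q => f q - g q).
Proof.
move=> sf sg; under eq_fun do rewrite -mulN1r.
by apply: smooth_nearD => //; exact: smooth_nearZ.
Qed.

(** Smoothness speaks of coordinate expressions only; near p the function is its coordinate
    expression composed with the continuous chart map. *)
Lemma smooth_near_continuous p f : smooth_near p f -> {for p, continuous f}.
Proof.
case=> U [oU Up] sf; have [c ac cp] := atlas_cover p.
have [[od _] dK _ dc _] := atlas_chart ac.
have [cmp mK] := dK p cp.
have [fc _] := sf c ac 0.
have /fc {}fc : chart_cod c (chart_map c p) /\ U (chart_inv c (chart_map c p)).
  by rewrite mK.
have fE : {near p, (f \o chart_inv c) \o chart_map c =1 f}.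
  apply: (@filterS _ _ _ (chart_dom c)); last exact: open_nbhs_nbhs.
  by move=> q /dK[_ /= ->].
have := continuous_comp (dc p cp) fc.
rewrite /prop_for /continuous_at /= mK; apply: cvg_trans; exact: near_eq_cvg.
Qed.

Lemma smooth_near_neq0 p f : smooth_near p f -> f p != 0 ->
  \forall q \near p, f q != 0.
Proof.
move=> /smooth_near_continuous fc fp.
apply: (fc (fun y => y != 0)).
by apply: open_nbhs_nbhs; split => //; exact: open_neq.
Qed.

Lemma smooth_nearV p f : smooth_near p f -> f p != 0 ->
  smooth_near p (fun q => (f q)^-1).
Proof.
move=> sf /(smooth_near_neq0 sf) /near_openP[V [oV Vp] f0].
case: sf => U [oU Up] sf; have oUV : open (U `&` V) by exact: openI.
exists (U `&` V); first by split.
apply: smooth_onV => //; first by move=> q [_ /f0].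
by apply: smooth_on_sub sf => q [].
Qed.

Lemma smooth_near_sum p (I : Type) (r : seq I) (P : pred I) (f : I -> M -> R) :
  (forall i, smooth_near p (f i)) ->
  smooth_near p (fun q => \sum_(i <- r | P i) f i q).
Proof.
move=> sf; elim: r => [|i r IH].
  by under eq_fun do rewrite big_nil; exact: smooth_near_cst.
under eq_fun do rewrite big_cons.
by case: (P i) => //; exact: smooth_nearD.
Qed.

Lemma smooth_near_prod p (I : Type) (r : seq I) (P : pred I) (f : I -> M -> R) :
  (forall i, smooth_near p (f i)) ->
  smooth_near p (fun q => \prod_(i <- r | P i) f i q).
Proof.
move=> sf; elim: r => [|i r IH].
  by under eq_fun do rewrite big_nil; exact: smooth_near_cst.
under eq_fun do rewrite big_cons.
by case: (P i) => //; exact: smooth_nearM.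
Qed.

Lemma smooth_near_det p k (A : M -> 'M[R]_k) :
  (forall i j, smooth_near p (fun q => A q i j)) ->
  smooth_near p (fun q => \det (A q)).
Proof.
move=> sA; apply: smooth_near_sum => s; apply: smooth_nearZ.
exact: smooth_near_prod.
Qed.

(** Cramer's rule: determinant and adjugate are polynomial in the entries, hence smooth, and the
    determinant stays nonzero near p. Pointwise linear conditions get smooth solutions from here. *)
Lemma smooth_near_solve p k (A : M -> 'M[R]_k) (b : M -> 'rV[R]_k) :
  (forall i j, smooth_near p (fun q => A q i j)) ->
  (forall j, smooth_near p (fun q => b q 0 j)) -> \det (A p) != 0 ->
  exists c : M -> 'rV[R]_k, (forall i, smooth_near p (fun q => c q 0 i)) /\
    \forall q \near p, \det (A q) != 0 /\ c q *m A q = b q.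
Proof.
move=> sA sb dp; have sd := smooth_near_det sA.
exists (fun q => (\det (A q))^-1 *: (b q *m \adj (A q))); split.
  move=> i; under eq_fun do rewrite !mxE.
  apply: smooth_nearM; first exact: smooth_nearV.
  apply: smooth_near_sum => j; under eq_fun do rewrite !mxE.
  apply: smooth_nearM => //; apply: smooth_nearZ.
  by apply: smooth_near_det => i' j'; under eq_fun do rewrite !mxE.
apply: filterS (smooth_near_neq0 sd dp) => q dq; split=> //.
by rewrite -scalemxAl -mulmxA mul_adj_mx mul_mx_scalar scalerA mulVf // scale1r.
Qed.

End SmoothFunctions.

(** * Tangent vectors and vector fields *)

Section VectorFields.
Variables (R : realType) (m : nat) (M : manifold R m).
Implicit Types (f g : M -> R) (p q : M) (v w : vec M) (X Y Z V : rough_field M).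

Lemma vsubvv v : vsub v v = @vzero _ _ M.
Proof. by apply/funext => f; rewrite /vsub subrr. Qed.

Lemma vsubKC v w : vadd w (vsub v w) = v.
Proof. by apply/funext => f; rewrite /vadd /vsub addrC subrK. Qed.

Lemma tangent_eq p v w : tangent p v -> tangent p w ->
  (forall f, smooth_near p f -> v f = w f) -> v = w.
Proof.
move=> [_ _ _ _ v0] [_ _ _ _ w0] vw; apply/funext => f.
by have [/vw //|sf] := pselect (smooth_near p f); rewrite v0 // w0.
Qed.

Lemma tangentD p v f g : tangent p v -> smooth_near p f -> smooth_near p g ->
  v (fun q => f q + g q) = v f + v g.
Proof. by case=> vD _ _ _ _; exact: vD. Qed.

Lemma tangentZ p v (a : R) f : tangent p v -> smooth_near p f ->
  v (fun q => a * f q) = a * v f.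
Proof. by case=> _ vZ _ _ _; exact: vZ. Qed.

Lemma tangentM p v f g : tangent p v -> smooth_near p f -> smooth_near p g ->
  v (fun q => f q * g q) = v f * g p + f p * v g.
Proof. by case=> _ _ vM _ _; exact: vM. Qed.

Lemma tangent_germ p v f g : tangent p v -> (\forall q \near p, f q = g q) ->
  v f = v g.
Proof. by case=> _ _ _ vG _; exact: vG. Qed.

Lemma tangent_nsmooth p v f : tangent p v -> ~ smooth_near p f -> v f = 0.
Proof. by case=> _ _ _ _ vN; exact: vN. Qed.

Lemma tangent_cst p v (a : R) : tangent p v -> v (fun=> a) = 0.
Proof.
move=> tv; have s1 := @smooth_near_cst _ _ M p 1.
have v1 : v (fun=> 1) = 0.
  apply: (addrI (v (fun=> 1))); rewrite addr0.
  by have := tangentM tv s1 s1; rewrite !mulr1 mul1r.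
rewrite (_ : (fun=> a) = (fun=> a * 1)); last by rewrite mulr1.
by rewrite (tangentZ a tv s1) v1 mulr0.
Qed.

Lemma tangentB p v f g : tangent p v -> smooth_near p f -> smooth_near p g ->
  v (fun q => f q - g q) = v f - v g.
Proof.
move=> tv sf sg; under eq_fun do rewrite -mulN1r.
by rewrite (tangentD tv sf (smooth_nearZ _ sg)) (tangentZ _ tv sg) mulN1r.
Qed.

Lemma tangent_sum p v (I : Type) (r : seq I) (f : I -> M -> R) : tangent p v ->
  (forall i, smooth_near p (f i)) ->
  v (fun q => \sum_(i <- r) f i q) = \sum_(i <- r) v (f i).
Proof.
move=> tv sf; elim: r => [|i r IH].
  rewrite [RHS]big_nil; apply: etrans (tangent_cst 0 tv); congr v.
  by apply/funext => q; rewrite big_nil.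
rewrite big_cons -IH -(tangentD tv (sf i)); last exact: smooth_near_sum.
by congr v; apply/funext => q; rewrite big_cons.
Qed.

Lemma tangent_vzero p : tangent p (@vzero _ _ M).
Proof.
by split=> // *; rewrite /vzero ?addr0 ?mulr0 // mul0r addr0.
Qed.

Lemma tangent_vadd p v w : tangent p v -> tangent p w -> tangent p (vadd v w).
Proof.
move=> tv tw; split=> [f g sf sg|a f sf|f g sf sg|f g fg|f nf]; rewrite /vadd.
- by rewrite (tangentD tv) // (tangentD tw) // addrACA.
- by rewrite (tangentZ _ tv) // (tangentZ _ tw) // mulrDr.
- by rewrite (tangentM tv) // (tangentM tw) //; ring.
- by rewrite (tangent_germ tv fg) (tangent_germ tw fg).
- by rewrite (tangent_nsmooth tv nf) (tangent_nsmooth tw nf) addr0.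
Qed.

Lemma tangent_vscale p (a : R) v : tangent p v -> tangent p (vscale a v).
Proof.
move=> tv; split=> [f g sf sg|b f sf|f g sf sg|f g fg|f nf]; rewrite /vscale.
- by rewrite (tangentD tv) // mulrDr.
- by rewrite (tangentZ _ tv) // mulrCA.
- by rewrite (tangentM tv) //; ring.
- by rewrite (tangent_germ tv fg).
- by rewrite (tangent_nsmooth tv nf) mulr0.
Qed.

Lemma vsubE v w : vsub v w = vadd v (vscale (-1) w).
Proof. by apply/funext => f; rewrite /vadd /vscale mulN1r. Qed.

Lemma tangent_vsub p v w : tangent p v -> tangent p w -> tangent p (vsub v w).
Proof. by move=> tv tw; rewrite vsubE; apply/tangent_vadd/tangent_vscale. Qed.

(** As an iterated [vadd], a linear combination inherits by induction every property that is stable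
    under sum and scaling. *)
Lemma vlinE k (c : 'I_k -> R) (W : 'I_k -> vec M) :
  vlin c W = \big[@vadd _ _ M/@vzero _ _ M]_(i < k) vscale (c i) (W i).
Proof.
apply/funext => f.
by rewrite (big_morph (fun v : vec M => v f) (id1 := 0) (op1 := +%R)).
Qed.

Lemma tangent_vlin p k (c : 'I_k -> R) (W : 'I_k -> vec M) :
  (forall i, tangent p (W i)) -> tangent p (vlin c W).
Proof.
move=> tW; rewrite vlinE; apply: big_ind => [|v w|i _].
- exact: tangent_vzero.
- exact: tangent_vadd.
- exact: tangent_vscale.
Qed.

Lemma vfield_tangent X p : vector_field X -> tangent p (X p).
Proof. by case. Qed.

Lemma vfield_smooth X p f : vector_field X -> smooth_near p f ->
  smooth_near p (act X f).
Proof. by case=> _; exact. Qed.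

Hint Extern 0 (tangent _ _) => (apply: vfield_tangent; assumption) : core.

Lemma act_vlin_smooth p k (c : M -> 'I_k -> R) (W : 'I_k -> rough_field M) V :
  (forall i, vector_field (W i)) -> (forall i, smooth_near p (c ^~ i)) ->
  (\forall q \near p, V q = vlin (c q) (W ^~ q)) ->
  forall f, smooth_near p f -> smooth_near p (act V f).
Proof.
move=> vW sc VE f sf.
apply: (@smooth_near_germ _ _ _ _ (fun q => \sum_i c q i * W i q f)).
  by apply: filterS VE => q; rewrite /act => ->.
apply: smooth_near_sum => i; apply: smooth_nearM => //; exact: vfield_smooth.
Qed.

Lemma vfield_vlin k (c : M -> 'I_k -> R) (W : 'I_k -> rough_field M) :
  (forall i, vector_field (W i)) -> (forall p i, smooth_near p (c ^~ i)) ->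
  vector_field (fun q => vlin (c q) (W ^~ q)).
Proof.
move=> vW sc; split=> p.
  by apply: tangent_vlin => i; exact: vfield_tangent.
by apply: act_vlin_smooth vW (sc p) _; exact: filterE.
Qed.

Lemma vfield_fscale f X : (forall p, smooth_near p f) -> vector_field X ->
  vector_field (fscale f X).
Proof.
move=> sf vX; split=> p; first exact: tangent_vscale.
by move=> g sg; apply: smooth_nearM => //; exact: vfield_smooth.
Qed.

Lemma vfield_fadd X Y : vector_field X -> vector_field Y ->
  vector_field (fadd X Y).
Proof.
move=> vX vY; split=> p; first exact: tangent_vadd.
by move=> g sg; apply: smooth_nearD; exact: vfield_smooth.
Qed.

Lemma vfield_fsub X Y : vector_field X -> vector_field Y ->
  vector_field (fsub X Y).
Proof.
move=> vX vY; split=> p; first exact: tangent_vsub.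
by move=> g sg; apply: smooth_nearB; exact: vfield_smooth.
Qed.

Lemma bracketE X Y p f : smooth_near p f ->
  bracket X Y p f = X p (act Y f) - Y p (act X f).
Proof. by move=> sf; rewrite /bracket; case: asboolP. Qed.

Lemma tangent_bracket X Y p : vector_field X -> vector_field Y ->
  tangent p (bracket X Y p).
Proof.
move=> vX vY.
have tX : tangent p (X p) by [].
have tY : tangent p (Y p) by [].
have sX f : smooth_near p f -> smooth_near p (act X f) by exact: vfield_smooth.
have sY f : smooth_near p f -> smooth_near p (act Y f) by exact: vfield_smooth.
(* Away from p the functions f and g may fail to be smooth, and the derivation rules for [act V] may
   fail with them. The rules are therefore stated near p only, which is enough to insert them under
   an outer tangent vector at p by [tangent_germ]. *)
have nDE V f g : vector_field V -> smooth_near p f -> smooth_near p g ->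
    \forall q \near p, act V (fun q => f q + g q) q = act V f q + act V g q.
  move=> vV sf sg; apply: filterS2 (smooth_near_near sf) (smooth_near_near sg).
  by move=> q sfq sgq; exact: (tangentD (vfield_tangent q vV)).
have nME V f g : vector_field V -> smooth_near p f -> smooth_near p g ->
    \forall q \near p, act V (fun q => f q * g q) q =
                       act V f q * g q + f q * act V g q.
  move=> vV sf sg; apply: filterS2 (smooth_near_near sf) (smooth_near_near sg).
  by move=> q sfq sgq; exact: (tangentM (vfield_tangent q vV)).
have nZE V (a : R) f : vector_field V -> smooth_near p f ->
    \forall q \near p, act V (fun q => a * f q) q = a * act V f q.
  move=> vV sf; apply: filterS (smooth_near_near sf) => q sfq.
  exact: (tangentZ a (vfield_tangent q vV)).
have nG V f g : vector_field V -> (\forall q \near p, f q = g q) ->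
    \forall q \near p, act V f q = act V g q.
  move=> vV /near_openP[U [oU Up] fg]; apply/near_openP; exists U => // q Uq.
  apply: (tangent_germ (vfield_tangent q vV)).
  by apply/near_openP; exists U.
split=> [f g sf sg|a f sf|f g sf sg|f g fg|f nf].
- rewrite !bracketE //; last exact: smooth_nearD.
  rewrite (tangent_germ tX (nDE Y f g vY sf sg)) (tangent_germ tY (nDE X f g vX sf sg)).
  by rewrite (tangentD tX) ?(tangentD tY) //; auto; ring.
- rewrite !bracketE //; last exact: smooth_nearZ.
  rewrite (tangent_germ tX (nZE Y a f vY sf)) (tangent_germ tY (nZE X a f vX sf)).
  by rewrite (tangentZ _ tX) ?(tangentZ _ tY) //; auto; ring.
- rewrite !bracketE //; last exact: smooth_nearM.
  rewrite (tangent_germ tX (nME Y f g vY sf sg)) (tangent_germ tY (nME X f g vX sf sg)).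
  rewrite (tangentD tX) ?(tangentD tY);
    [|by apply: smooth_nearM; auto..].
  rewrite (tangentM tX (sY f sf) sg) (tangentM tX sf (sY g sg)).
  rewrite (tangentM tY (sX f sf) sg) (tangentM tY sf (sX g sg)).
  by rewrite /act; ring.
- have [sf|nf] := pselect (smooth_near p f); last first.
    rewrite /bracket; case: asboolP => // _; case: asboolP => // sg.
    case: nf; apply: smooth_near_germ sg.
    by apply: filterS fg.
  have sg : smooth_near p g by exact: smooth_near_germ sf.
  rewrite !bracketE // (tangent_germ tX (nG Y f g vY fg)).
  by rewrite (tangent_germ tY (nG X f g vX fg)).
- by rewrite /bracket; case: asboolP.
Qed.

Lemma bracket_near X Y p f : smooth_near p f ->
  \forall q \near p, act (bracket X Y) f q = act X (act Y f) q - act Y (act X f) q.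
Proof.
by move=> sf; apply: filterS (smooth_near_near sf) => q; exact: bracketE.
Qed.

Lemma vfield_bracket X Y : vector_field X -> vector_field Y ->
  vector_field (bracket X Y).
Proof.
move=> vX vY; split=> p; first exact: tangent_bracket.
move=> f sf; have nE := bracket_near X Y sf.
apply: (@smooth_near_germ _ _ _ _ (fun q => act X (act Y f) q - act Y (act X f) q)).
  by apply: filterS nE.
by apply: smooth_nearB; do 2?apply: vfield_smooth.
Qed.

Lemma bracketC X Y p : bracket Y X p = vscale (-1) (bracket X Y p).
Proof.
apply/funext => f; rewrite /vscale /bracket; case: asboolP => _.
  by rewrite mulN1r opprB.
by rewrite mulr0.
Qed.

Lemma bracket_jacobi X Y Z p : vector_field X -> vector_field Y -> vector_field Z ->
  vadd (vadd (bracket (bracket X Y) Z p) (bracket (bracket Y Z) X p))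
       (bracket (bracket Z X) Y p) = @vzero _ _ M.
Proof.
move=> vX vY vZ; apply: (@tangent_eq p).
- by do 2?apply: tangent_vadd; apply: tangent_bracket => //; exact: vfield_bracket.
- exact: tangent_vzero.
move=> f sf; rewrite /vadd /vzero.
have bb A B C : vector_field A -> vector_field B -> vector_field C ->
    bracket (bracket A B) C p f = A p (act B (act C f)) - B p (act A (act C f))
      - (C p (act A (act B f)) - C p (act B (act A f))).
  move=> vA vB vC; rewrite !bracketE //; last exact: vfield_smooth.
  rewrite (tangent_germ (vfield_tangent p vC) (bracket_near A B sf)).
  by rewrite (tangentB (vfield_tangent p vC)) //; do 2?apply: vfield_smooth.
by rewrite !bb //; ring.
Qed.

(** V is expanded only near p, since a local frame gives coefficients only there. The terms Y(c_i)
    W_i are those that cancel in the proof that d theta is tensorial. *)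
Lemma bracket_vlin p k (c : M -> 'I_k -> R) (W : 'I_k -> rough_field M) V Y :
  (forall i, vector_field (W i)) -> (forall i, smooth_near p (c ^~ i)) ->
  (\forall q \near p, V q = vlin (c q) (W ^~ q)) ->
  vector_field V -> vector_field Y ->
  bracket V Y p = vsub (vlin (c p) (fun i => bracket (W i) Y p))
                       (vlin (fun i => Y p (c ^~ i)) (W ^~ p)).
Proof.
move=> vW sc VE vV vY; have tY := vfield_tangent p vY.
apply: (@tangent_eq p); first exact: tangent_bracket.
  apply: tangent_vsub; apply: tangent_vlin => i; last exact: vfield_tangent.
  exact: tangent_bracket.
move=> f sf; rewrite bracketE // /vsub /vlin.
rewrite (nbhs_singleton VE).
have VfE : \forall q \near p, act V f q = \sum_i c q i * act (W i) f q.
  by apply: filterS VE => q; rewrite /act => ->.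
rewrite (tangent_germ tY VfE) (tangent_sum _ tY); last first.
  by move=> i; apply: smooth_nearM => //; exact: vfield_smooth.
rewrite /vlin -!sumrB; apply: eq_bigr => i _.
rewrite (tangentM tY (sc i)); last exact: vfield_smooth.
by rewrite bracketE // /act; ring.
Qed.

End VectorFields.
#[global] Hint Extern 0 (tangent _ _) => (apply: vfield_tangent; assumption) : core.

(** * Frames and one-forms *)

(** Independent functions are separated by finitely many points. Applied with tangent vectors as
    functions of their argument, the points become test functions, which take the place of
    coordinates. *)
Lemma independent_det (R : fieldType) (T : Type) k (v : 'I_k -> T -> R) :
  (forall c : 'I_k -> R, (forall x, \sum_i c i * v i x = 0) -> forall i, c i = 0) ->
  exists x : 'I_k -> T, \det (\matrix_(i, j) v i (x j)) != 0.
Proof.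
elim: k v => [|k IH] v vfree.
  exists (fun i : 'I_0 => False_rect T (notF (ltn_ord i))).
  by rewrite det_mx00 oner_eq0.
have [|x' dx'] := IH (fun i => v (lift ord0 i)).
  move=> c c0 i; pose c' j := oapp c 0 (unlift ord0 j).
  have := vfree c' _ (lift ord0 i); rewrite /c' liftK; apply=> x.
  rewrite big_ord_recl unlift_none mul0r add0r -[RHS](c0 x).
  by apply: eq_bigr => j _; rewrite liftK.
pose B := \matrix_(i, j) v i (x' j).
(* The cofactors along a new first column. If the combination of the v_i with these coefficients
   vanished at every x0, independence would give [C ord0 = 0]; but [C ord0] is the minor that is
   nonzero by induction. *)
pose C (i : 'I_k.+1) : R := (-1) ^+ i * \det (row' i B : 'M[R]_k).
suff [x0 dx0] : exists x0, \sum_i C i * v i x0 != 0.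
  exists (fun j => oapp x' x0 (unlift ord0 j)).
  rewrite (expand_det_col _ ord0); apply: contra_neq dx0 => dx0; rewrite -[RHS]dx0.
  apply: eq_bigr => i _; rewrite mxE unlift_none mulrC; congr (_ * _).
  rewrite /cofactor addn0; congr (_ * \det _).
  by apply/matrixP => a b; rewrite !mxE liftK.
apply: contrapT => /forallNP C0.
have /eqP := vfree C (fun x => contrapT (contra_not (fun h => introN eqP h) (C0 x))) ord0.
rewrite /C mul1r; apply/negP; apply: contra_neq dx' => dx0; rewrite -[RHS]dx0; congr (\det _).
by apply/matrixP => a b; rewrite !mxE.
Qed.

Section Frames.
Variables (R : realType) (m : nat) (M : manifold R m).
Implicit Types (f g : M -> R) (p q : M) (v w : vec M) (X Y Z V : rough_field M).

(** Evaluating V on the test functions of [independent_det] gives a linear system with smooth data.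
    It is invertible near p, so any choice of coefficients c, however made, coincides there with the
    smooth solution. *)
Lemma frame_coef_smooth p k (c : M -> 'I_k -> R) (W : 'I_k -> rough_field M) V :
  (forall i, vector_field (W i)) ->
  (forall c, vlin c (W ^~ p) = @vzero _ _ M -> forall i, c i = 0) ->
  (\forall q \near p, V q = vlin (c q) (W ^~ q)) ->
  (forall f, smooth_near p f -> smooth_near p (act V f)) ->
  forall i, smooth_near p (c ^~ i).
Proof.
move=> vW free VE sV.
have [|x dx] := @independent_det _ (M -> R) k (fun i => W i p).
  by move=> c' c'0; apply: free; apply/funext => f; rewrite /vlin c'0.
(* A tangent vector is 0 on functions that are not smooth near p, so a bad test function would
   produce a zero column. *)
have sx j : smooth_near p (x j).
  apply: contrapT => nx; move/negP: dx; apply; apply/eqP.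
  rewrite (expand_det_col _ j) big1 // => i _; rewrite mxE.
  by rewrite (tangent_nsmooth (vfield_tangent p (vW i)) nx) mul0r.
pose A q : 'M[R]_k := \matrix_(i, j) W i q (x j).
pose b q : 'rV[R]_k := \row_j V q (x j).
have [||//|c' [sc' c'E]] := @smooth_near_solve _ _ M p k A b.
- by move=> i j; under eq_fun do rewrite mxE; exact: vfield_smooth.
- by move=> j; under eq_fun do rewrite mxE; exact: sV.
move=> i; apply: smooth_near_germ (sc' i).
apply: filterS2 VE c'E => q VE [dA c'A].
have uA : A q \in unitmx by rewrite unitmxE unitfE.
have -> : c' q = \row_i c q i; last by rewrite mxE.
apply: (can_inj (mulmxK uA)); rewrite c'A; apply/rowP => j; rewrite !mxE VE.
by apply: eq_bigr => l _; rewrite !mxE.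
Qed.

(** Uniqueness replaces a partition of unity: near p the pointwise choice must agree with the local
    solution, whose coefficients are smooth at p. *)
Lemma glue_vector_field (P : M -> vec M -> Prop) :
  (forall q v w, P q v -> P q w -> v = w) ->
  (forall p, exists k (W : 'I_k -> rough_field M) (c : M -> 'I_k -> R),
    [/\ forall i, vector_field (W i), forall i, smooth_near p (c ^~ i) &
        \forall q \near p, P q (vlin (c q) (W ^~ q))]) ->
  exists2 V, vector_field V & forall p, P p (V p).
Proof.
move=> Puniq Ploc; exists (fun p => xget (@vzero _ _ M) (P p)).
  split=> p; have [k [W [c [vW sc PW]]]] := Ploc p.
    case: xgetP => [v _ Pv|]; last by move=> _; exact: tangent_vzero.
    rewrite (Puniq _ _ _ Pv (nbhs_singleton PW)).
    by apply: tangent_vlin => i; exact: vfield_tangent.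
  apply: (act_vlin_smooth vW sc); apply: filterS PW => q PW.
  by apply: (Puniq q) => //; exact: (@xgetI _ _ (P q) _ PW).
move=> p; have [k [W [c [vW sc PW]]]] := Ploc p.
exact: (@xgetI _ _ (P p) _ (nbhs_singleton PW)).
Qed.

End Frames.

Section OneForms.
Variables (R : realType) (m : nat) (M : manifold R m).
Variable theta : rough_form M.
Hypothesis thetaP : one_form theta.
Implicit Types (f g : M -> R) (p q : M) (v w : vec M) (X Y Z V : rough_field M).

Lemma ev_smooth p X : vector_field X -> smooth_near p (ev theta X).
Proof. by case: thetaP => _ _ h /h; exact: smoothP. Qed.

Lemma formD p v w : tangent p v -> tangent p w ->
  theta p (vadd v w) = theta p v + theta p w.
Proof. by case: thetaP => h _ _; exact: h. Qed.

Lemma formZ p (a : R) v : tangent p v -> theta p (vscale a v) = a * theta p v.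
Proof. by case: thetaP => _ h _; exact: h. Qed.

Lemma form0 p : theta p (@vzero _ _ M) = 0.
Proof.
rewrite -(mul0r (theta p (@vzero _ _ M))) -formZ; last exact: tangent_vzero.
by congr theta; apply/funext => f; rewrite /vscale mul0r.
Qed.

Lemma formB p v w : tangent p v -> tangent p w ->
  theta p (vsub v w) = theta p v - theta p w.
Proof.
move=> tv tw; rewrite vsubE formD //; last exact: tangent_vscale.
by rewrite formZ // mulN1r.
Qed.

Lemma form_vlin p k (c : 'I_k -> R) (W : 'I_k -> vec M) :
  (forall i, tangent p (W i)) ->
  theta p (vlin c W) = \sum_i c i * theta p (W i).
Proof.
move=> tW; rewrite vlinE.
suff [] : tangent p (\big[@vadd _ _ M/@vzero _ _ M]_(i < k) vscale (c i) (W i)) /\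
  theta p (\big[@vadd _ _ M/@vzero _ _ M]_(i < k) vscale (c i) (W i)) =
  \sum_i c i * theta p (W i) by [].
elim/big_ind2: _ => [|v a w b [tv <-] [tw <-]|i _].
- by split; [exact: tangent_vzero|exact: form0].
- by split; [exact: tangent_vadd|exact: formD].
- by split; [exact: tangent_vscale|exact: formZ].
Qed.

Lemma ext_dC X Y p : vector_field X -> vector_field Y ->
  ext_d theta Y X p = - ext_d theta X Y p.
Proof.
move=> vX vY; rewrite /ext_d bracketC formZ; last exact: tangent_bracket.
by ring.
Qed.

Lemma ext_d_smooth p X Y : vector_field X -> vector_field Y ->
  smooth_near p (ext_d theta X Y).
Proof.
move=> vX vY; do 2?apply: smooth_nearB; do ?apply: vfield_smooth => //.
- exact: ev_smooth.
- exact: ev_smooth.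
- exact: (ev_smooth p (vfield_bracket vX vY)).
Qed.

(** Linearity over functions: the terms Y(c_i) theta(W_i) arise once from Y(theta(V)) and once from
    the bracket, with opposite signs. *)
Lemma ext_d_vlin p k (c : M -> 'I_k -> R) (W : 'I_k -> rough_field M) V Y :
  (forall i, vector_field (W i)) -> (forall i, smooth_near p (c ^~ i)) ->
  (\forall q \near p, V q = vlin (c q) (W ^~ q)) ->
  vector_field V -> vector_field Y ->
  ext_d theta V Y p = \sum_i c p i * ext_d theta (W i) Y p.
Proof.
move=> vW sc VE vV vY; have tY := vfield_tangent p vY.
have tW q i := vfield_tangent q (vW i).
have tB i := tangent_bracket p (vW i) vY.
rewrite /ext_d (bracket_vlin vW sc VE vV vY) formB ?form_vlin //;
  [|exact: tangent_vlin..].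
have evE : \forall q \near p, ev theta V q = \sum_i c q i * ev theta (W i) q.
  by apply: filterS VE => q; rewrite /ev => ->; exact: form_vlin.
rewrite /act (tangent_germ tY evE) (tangent_sum _ tY); last first.
  by move=> i; apply: smooth_nearM => //; exact: ev_smooth.
rewrite {1}(nbhs_singleton VE) /vlin -!sumrB; apply: eq_bigr => i _.
rewrite (tangentM tY (sc i)) /ev; last exact: ev_smooth.
by ring.
Qed.

(** The identity d(d theta) = 0 in invariant form. After expansion all derivatives of the functions
    theta(X), theta([X, Y]) and their cyclic analogues cancel, and the difference of the two sides
    is theta of the Jacobi sum. *)
Lemma ext_d_closed X Y Z p : vector_field X -> vector_field Y -> vector_field Z ->
  act X (ext_d theta Y Z) p + act Y (ext_d theta Z X) p + act Z (ext_d theta X Y) p =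
  ext_d theta (bracket X Y) Z p + ext_d theta (bracket Y Z) X p
    + ext_d theta (bracket Z X) Y p.
Proof.
move=> vX vY vZ.
have dE A B C : vector_field A -> vector_field B -> vector_field C ->
    act A (ext_d theta B C) p = A p (act B (ev theta C)) - A p (act C (ev theta B))
      - A p (ev theta (bracket B C)).
  move=> vA vB vC; have tA := vfield_tangent p vA.
  have sB := ev_smooth p vB; have sC := ev_smooth p vC.
  have sBC := ev_smooth p (vfield_bracket vB vC).
  rewrite /act /ext_d (tangentB tA) //; last first.
    by apply: smooth_nearB; apply: vfield_smooth.
  by rewrite (tangentB tA) //; apply: vfield_smooth.
have bE A B C : vector_field A -> vector_field B -> vector_field C ->
    ext_d theta (bracket A B) C p = A p (act B (ev theta C)) - B p (act A (ev theta C))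
      - C p (ev theta (bracket A B)) - theta p (bracket (bracket A B) C p).
  by move=> vA vB vC; rewrite /ext_d /act bracketE //; exact: ev_smooth.
rewrite !dE // !bE //.
have := form0 p; rewrite -(bracket_jacobi p vX vY vZ).
have tb A B C : vector_field A -> vector_field B -> vector_field C ->
    tangent p (bracket (bracket A B) C p).
  by move=> vA vB vC; apply: tangent_bracket => //; exact: vfield_bracket.
rewrite !formD; [|by [apply: tb|apply: tangent_vadd; apply: tb]..].
move=> J; apply/eqP; rewrite -subr_eq0; apply/eqP; rewrite -{1}J.
by ring.
Qed.

End OneForms.

(** * Subbundles of TM, sections of their quotients, and tensoriality of d theta *)

Section Distributions.
Variables (R : realType) (m : nat) (M : manifold R m).
Implicit Types (p q : M) (v w : vec M) (X Y Z V : rough_field M).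

Lemma vlin0 k (W : 'I_k -> vec M) : vlin (fun=> 0) W = @vzero _ _ M.
Proof. by apply/funext => f; apply: big1 => i _; rewrite mul0r. Qed.

Lemma vadd_vlin k (c d : 'I_k -> R) (W : 'I_k -> vec M) :
  vadd (vlin c W) (vlin d W) = vlin (fun i => c i + d i) W.
Proof.
apply/funext => f; rewrite /vadd /vlin -big_split /=.
by apply: eq_bigr => i _; rewrite mulrDl.
Qed.

Lemma vscale_vlin k (a : R) (c : 'I_k -> R) (W : 'I_k -> vec M) :
  vscale a (vlin c W) = vlin (fun i => a * c i) W.
Proof.
apply/funext => f; rewrite /vscale /vlin mulr_sumr.
by apply: eq_bigr => i _; rewrite mulrA.
Qed.

Definition frame_cons k Z (X : 'I_k -> rough_field M) (i : 'I_k.+1) :=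
  oapp X Z (unlift ord0 i).

Lemma vlin_cons k (c : 'I_k.+1 -> R) Z (X : 'I_k -> rough_field M) q :
  vlin c (frame_cons Z X ^~ q) =
  vadd (vscale (c ord0) (Z q)) (vlin (fun i => c (lift ord0 i)) (X ^~ q)).
Proof.
apply/funext => f; rewrite /vlin /vadd /vscale big_ord_recl /frame_cons unlift_none.
by congr (_ + _); apply: eq_bigr => i _; rewrite liftK.
Qed.

Lemma vfield_cons k Z (X : 'I_k -> rough_field M) : vector_field Z ->
  (forall i, vector_field (X i)) -> forall i, vector_field (frame_cons Z X i).
Proof. by move=> vZ vX i; rewrite /frame_cons; case: unliftP => [j|] _ /=. Qed.

Section Subbundle.
Variables (k : nat) (K : dist M).
Hypothesis sK : subbundle k K.

Lemma subbundle_frame p : exists X : 'I_k -> rough_field M,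
  (forall i, section K (X i)) /\
  (forall v, K p v <-> exists c, v = vlin c (X ^~ p)).
Proof. by have [X [sX /nbhs_singleton[KX _]]] := sK p; exists X. Qed.

Lemma dist_tangent p v : K p v -> tangent p v.
Proof.
have [X [sX KX]] := subbundle_frame p => /KX[c ->].
by apply: tangent_vlin => i; apply: vfield_tangent; case: (sX i).
Qed.

Lemma dist_vzero p : K p (@vzero _ _ M).
Proof.
by have [X [_ KX]] := subbundle_frame p; apply/KX; exists (fun=> 0); rewrite vlin0.
Qed.

Lemma dist_vadd p v w : K p v -> K p w -> K p (vadd v w).
Proof.
have [X [_ KX]] := subbundle_frame p => /KX[c ->] /KX[d ->].
by apply/KX; rewrite vadd_vlin; eexists.
Qed.

Lemma dist_vscale p (a : R) v : K p v -> K p (vscale a v).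
Proof.
have [X [_ KX]] := subbundle_frame p => /KX[c ->].
by apply/KX; rewrite vscale_vlin; eexists.
Qed.

Lemma dist_vsub p v w : K p v -> K p w -> K p (vsub v w).
Proof. by move=> Kv Kw; rewrite vsubE; apply/dist_vadd/dist_vscale. Qed.

Lemma dist_vlin p l (c : 'I_l -> R) (W : 'I_l -> vec M) :
  (forall i, K p (W i)) -> K p (vlin c W).
Proof.
move=> KW; rewrite vlinE; apply: big_ind => [|v w|i _].
- exact: dist_vzero.
- exact: dist_vadd.
- exact: dist_vscale.
Qed.

Lemma dist_ext p v : K p v -> exists2 X, section K X & X p = v.
Proof.
have [X [sX KX]] := subbundle_frame p => /KX[c ->].
exists (fun q => vlin c (X ^~ q)) => //; split.
  by apply: vfield_vlin => [i|*]; [case: (sX i)|exact: smooth_near_cst].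
by move=> q; apply: dist_vlin => i; case: (sX i).
Qed.

Lemma coset_eqP p X Y : coset K X p = coset K Y p <-> K p (vsub (X p) (Y p)).
Proof.
split=> [XY|KXY].
  have : coset K Y p (Y p) by rewrite /coset /= vsubvv; exact: dist_vzero.
  by rewrite -XY.
apply/seteqP; split=> v; rewrite /coset /= => Kv.
  rewrite (_ : vsub _ _ = vsub (vsub (X p) v) (vsub (X p) (Y p))).
    exact: dist_vsub.
  by apply/funext => f; rewrite /vsub; ring.
rewrite (_ : vsub _ _ = vadd (vsub (Y p) v) (vsub (X p) (Y p))).
  exact: dist_vadd.
by apply/funext => f; rewrite /vsub /vadd; ring.
Qed.

(** The vectors picked by [rep] need not depend smoothly on the point. What is known of them is this
    difference, which suffices because the operations on quotient sections are computed modulo K. *)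
Lemma rep_coset p X : K p (vsub (X p) (rep (coset K X) p)).
Proof.
apply: (@xgetI _ (@vzero _ _ M) (coset K X p) (X p)).
by rewrite /coset /= vsubvv; exact: dist_vzero.
Qed.

Lemma coset_rep X : coset K (rep (coset K X)) = coset K X.
Proof. by apply/funext => p; apply/esym/coset_eqP; exact: rep_coset. Qed.

Lemma tangent_rep p X : tangent p (X p) -> tangent p (rep (coset K X) p).
Proof.
move=> tX; rewrite (_ : rep _ _ = vsub (X p) (vsub (X p) (rep (coset K X) p))).
  by apply: tangent_vsub => //; exact: dist_tangent (rep_coset p X).
by apply/funext => f; rewrite /vsub; ring.
Qed.

Lemma qadd_coset X Y : qadd K (coset K X) (coset K Y) = coset K (fadd X Y).
Proof.
apply/funext => p; apply/esym/coset_eqP.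
rewrite (_ : vsub _ _ = vadd (vsub (X p) (rep (coset K X) p))
                             (vsub (Y p) (rep (coset K Y) p))).
  by apply: dist_vadd; exact: rep_coset.
by apply/funext => f; rewrite /vsub /vadd /fadd /vadd; ring.
Qed.

Lemma qscale_coset f X : qscale K f (coset K X) = coset K (fscale f X).
Proof.
apply/funext => p; apply/esym/coset_eqP.
rewrite (_ : vsub _ _ = vscale (f p) (vsub (X p) (rep (coset K X) p))).
  by apply: dist_vscale; exact: rep_coset.
by apply/funext => g; rewrite /vsub /fscale /vscale; ring.
Qed.

Lemma section_fadd X Y : section K X -> section K Y -> section K (fadd X Y).
Proof.
by move=> [vX KX] [vY KY]; split=> [|p]; [exact: vfield_fadd|exact: dist_vadd].
Qed.

Lemma section_fsub X Y : section K X -> section K Y -> section K (fsub X Y).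
Proof.
by move=> [vX KX] [vY KY]; split=> [|p]; [exact: vfield_fsub|exact: dist_vsub].
Qed.

Lemma section_fscale f X : (forall p, smooth_near p f) -> section K X ->
  section K (fscale f X).
Proof.
by move=> sf [vX KX]; split=> [|p]; [exact: vfield_fscale|exact: dist_vscale].
Qed.

End Subbundle.

Section TangentFrame.
Variables (k : nat) (H : dist M).
Hypotheses (sH : subbundle k H) (cH : corank_one H).

Lemma corank_one_frame p : exists (X : 'I_k -> rough_field M) Z,
  [/\ forall i, section H (X i), vector_field Z &
    \forall q \near p, [/\ forall v, H q v <-> exists c, v = vlin c (X ^~ q),
      forall c, vlin c (X ^~ q) = @vzero _ _ M -> forall i, c i = 0,
      ~ H q (Z q) & forall v, tangent q v -> exists c, H q (vsub v (vscale c (Z q)))]].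
Proof.
have [X [sX nX]] := sH p; have [Z [vZ nZ]] := cH p.
by exists X, Z; split=> //; apply: filterS2 nX nZ => q [? ?] [? ?].
Qed.

Lemma tangent_frame p : exists W : 'I_k.+1 -> rough_field M,
  [/\ forall i, vector_field (W i),
    forall c, vlin c (W ^~ p) = @vzero _ _ M -> forall i, c i = 0 &
    \forall q \near p, forall v, tangent q v -> exists c, v = vlin c (W ^~ q)].
Proof.
have [X [Z [sX vZ nXZ]]] := corank_one_frame p.
have vX i : vector_field (X i) by case: (sX i).
exists (frame_cons Z X); split; first exact: vfield_cons.
  move=> c; rewrite vlin_cons => c0.
  have [HX free nZ _] := nbhs_singleton nXZ.
  have c00 : c ord0 = 0.
    apply/eqP; apply: contra_notT nZ => c00.
    have -> : Z p = vscale (- (c ord0)^-1) (vlin (fun i => c (lift ord0 i)) (X ^~ p)).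
      apply/funext => f; have /(congr1 (fun v => v f)) := c0.
      rewrite /vadd /vscale /vzero => /eqP; rewrite addrC addr_eq0 => /eqP ->.
      by rewrite mulrNN mulKf.
    by apply: (dist_vscale sH); apply: (dist_vlin sH) => i; case: (sX i).
  move=> i; have [j ->|-> //] := unliftP ord0 i.
  apply: (free (fun j => c (lift ord0 j))); rewrite -c0 c00.
  by apply/funext => f; rewrite /vadd /vscale mul0r add0r.
apply: filterS nXZ => q [HX _ _ ZX] v /ZX[a /HX[d vE]].
exists (fun i => oapp d a (unlift ord0 i)); rewrite vlin_cons unlift_none /=.
rewrite (_ : (fun i => _) = d); last by apply/funext => i; rewrite liftK.
by rewrite -vE vsubKC.
Qed.

Lemma tangent_ext p v : tangent p v -> exists2 X, vector_field X & X p = v.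
Proof.
have [W [vW _ nW]] := tangent_frame p.
move=> /(nbhs_singleton nW)[c ->]; exists (fun q => vlin c (W ^~ q)) => //.
by apply: vfield_vlin => // *; exact: smooth_near_cst.
Qed.

(** Tensoriality: by [ext_d_vlin] the value at p involves V only through its coefficients at p in a
    frame. *)
Lemma ext_d_point (theta : rough_form M) p V V' Y : one_form theta ->
  vector_field V -> vector_field V' -> vector_field Y -> V p = V' p ->
  ext_d theta V Y p = ext_d theta V' Y p.
Proof.
move=> thetaP vV vV' vY VV'; have [W [vW free nW]] := tangent_frame p.
(* The choice sees U only through the vector U q, so fields that agree at p receive literally the
   same coefficients at p. *)
pose c (U : rough_field M) q := xget (fun=> 0) [set c | U q = vlin c (W ^~ q)].
have cE U : vector_field U -> \forall q \near p, U q = vlin (c U q) (W ^~ q).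
  move=> vU; apply: filterS nW => q /(_ (U q) (vfield_tangent q vU))[d Ud].
  exact: (@xgetI _ (fun=> 0) [set c | U q = vlin c (W ^~ q)] d).
have sc U i : vector_field U -> smooth_near p (c U ^~ i).
  move=> vU; apply: (frame_coef_smooth vW free (cE U vU)).
  by move=> f; exact: vfield_smooth.
have dE U : vector_field U ->
    ext_d theta U Y p = \sum_i c U p i * ext_d theta (W i) Y p.
  by move=> vU; apply: (ext_d_vlin thetaP vW) => //; [move=> i; exact: sc|exact: cE].
rewrite !dE //; suff -> : c V p = c V' p by [].
by rewrite /c VV'.
Qed.

End TangentFrame.

End Distributions.

(** * Contact forms *)

Section ContactForm.
Variables (R : realType) (n : nat) (M : manifold R n.*2.+1) (H : dist M).
Hypothesis HP : contact_structure H.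
Variable theta : rough_form M.
Hypothesis thetaH : contact_form H theta.
Implicit Types (p q : M) (v w u : vec M) (X Y Z V eta xi : rough_field M).

Let sH : subbundle n.*2 H. Proof. by case: HP. Qed.
Let cH : corank_one H. Proof. by case: HP. Qed.
Let thetaP : one_form theta. Proof. by case: thetaH. Qed.

Lemma contact_formP p v : tangent p v -> theta p v = 0 <-> H p v.
Proof. by case: thetaH => _; exact. Qed.

Lemma contact_form_dist p v : H p v -> theta p v = 0.
Proof. by move=> Hv; apply/contact_formP => //; exact: dist_tangent Hv. Qed.

Lemma ev_section eta : section H eta -> ev theta eta = fun=> 0.
Proof. by move=> [_ Heta]; apply/funext => p; exact: contact_form_dist. Qed.

Lemma coset_form_eqP p X Y : tangent p (X p) -> tangent p (Y p) ->
  coset H X p = coset H Y p <-> theta p (X p) = theta p (Y p).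
Proof.
move=> tX tY; rewrite (coset_eqP sH) -(contact_formP (tangent_vsub tX tY)).
by rewrite (formB thetaP tX tY); split=> [/eqP|->]; rewrite ?subrr ?subr_eq0 // => /eqP.
Qed.

Lemma coset_form_eq X Y : (forall p, tangent p (X p)) -> (forall p, tangent p (Y p)) ->
  ev theta X = ev theta Y -> coset H X = coset H Y.
Proof.
move=> tX tY XY; apply/funext => p; apply/coset_form_eqP => //.
exact: (congr1 (fun f => f p) XY).
Qed.

Lemma qev_coset X : (forall p, tangent p (X p)) ->
  qev theta (coset H X) = ev theta X.
Proof.
move=> tX; apply/funext => p; apply/esym/coset_form_eqP => //.
  exact: (tangent_rep sH).
by rewrite (coset_rep sH).
Qed.

(* [omega theta p] is the bilinear form [d theta] at p; by [ext_d_point] it does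
   not depend on the extensions. *)
Definition vext p v : rough_field M :=
  xget (fun=> @vzero _ _ M) [set X | vector_field X /\ X p = v].

Definition omega p v w : R := ext_d theta (vext p v) (vext p w) p.

Lemma vextP p v : tangent p v -> vector_field (vext p v) /\ vext p v p = v.
Proof.
move=> /(tangent_ext sH cH)[X vX Xp].
exact: (@xgetI _ _ [set X | vector_field X /\ X p = v] X).
Qed.

Lemma omegaE p X Y : vector_field X -> vector_field Y ->
  omega p (X p) (Y p) = ext_d theta X Y p.
Proof.
move=> vX vY; have [vX' X'p] := vextP (vfield_tangent p vX).
have [vY' Y'p] := vextP (vfield_tangent p vY).
rewrite /omega (ext_d_point sH cH thetaP vX' vX) // (ext_dC thetaP) //.
by rewrite (ext_d_point sH cH thetaP vY' vY) // -(ext_dC thetaP).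
Qed.

Lemma omegaC p v w : tangent p v -> tangent p w -> omega p w v = - omega p v w.
Proof.
by move=> /vextP[vX _] /vextP[vY _]; rewrite /omega (ext_dC thetaP).
Qed.

Lemma omega_vlin p k (c : 'I_k -> R) (W : 'I_k -> vec M) w :
  (forall i, tangent p (W i)) -> tangent p w ->
  omega p (vlin c W) w = \sum_i c i * omega p (W i) w.
Proof.
move=> tW /vextP[vY Yp]; rewrite -Yp.
have vW i : vector_field (vext p (W i)) by have [] := vextP (tW i).
have Wp i : vext p (W i) p = W i by have [] := vextP (tW i).
have -> : vlin c W = vlin c ((fun i => vext p (W i)) ^~ p).
  by congr vlin; apply/funext => i; rewrite Wp.
set V : rough_field M := fun q => vlin c ((fun i => vext p (W i)) ^~ q).
have vV : vector_field V by apply: vfield_vlin => // *; exact: smooth_near_cst.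
rewrite -[vlin _ _]/(V p) omegaE //.
rewrite (@ext_d_vlin _ _ _ _ thetaP p k (fun=> c) (fun i => vext p (W i))) //.
- by apply: eq_bigr => i _; rewrite -omegaE // Wp.
- by move=> i; exact: smooth_near_cst.
- exact: filterE.
Qed.

Lemma omegaD p v v' w : tangent p v -> tangent p v' -> tangent p w ->
  omega p (vadd v v') w = omega p v w + omega p v' w.
Proof.
move=> tv tv' tw; pose W (i : 'I_2) := if i == ord0 then v else v'.
have -> : vadd v v' = vlin (fun=> 1) W.
  by apply/funext => f; rewrite /vlin !big_ord_recl big_ord0 addr0 !mul1r.
rewrite omega_vlin // => [|i]; last by rewrite /W; case: ifP.
by rewrite !big_ord_recl big_ord0 addr0 !mul1r.
Qed.

Lemma omegaZ p (a : R) v w : tangent p v -> tangent p w ->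
  omega p (vscale a v) w = a * omega p v w.
Proof.
move=> tv tw; have -> : vscale a v = vlin (fun=> a) (fun _ : 'I_1 => v).
  by apply/funext => f; rewrite /vlin big_ord_recl big_ord0 addr0.
by rewrite omega_vlin // big_ord_recl big_ord0 addr0.
Qed.

Lemma omegaB p v v' w : tangent p v -> tangent p v' -> tangent p w ->
  omega p (vsub v v') w = omega p v w - omega p v' w.
Proof.
move=> tv tv' tw; rewrite vsubE omegaD //; last exact: tangent_vscale.
by rewrite omegaZ // mulN1r.
Qed.

Lemma omegaDr p v w w' : tangent p v -> tangent p w -> tangent p w' ->
  omega p v (vadd w w') = omega p v w + omega p v w'.
Proof.
move=> tv tw tw'; rewrite omegaC //; last exact: tangent_vadd.
by rewrite omegaD // opprD -(@omegaC p w v) // -(@omegaC p w' v).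
Qed.

Lemma omegaZr p (a : R) v w : tangent p v -> tangent p w ->
  omega p v (vscale a w) = a * omega p v w.
Proof.
move=> tv tw; rewrite omegaC //; last exact: tangent_vscale.
by rewrite omegaZ // -mulrN -omegaC.
Qed.

Lemma omega_vlinr p k (c : 'I_k -> R) (W : 'I_k -> vec M) v :
  tangent p v -> (forall i, tangent p (W i)) ->
  omega p v (vlin c W) = \sum_i c i * omega p v (W i).
Proof.
move=> tv tW; rewrite omegaC ?omega_vlin // -?sumrN; last exact: tangent_vlin.
by apply: eq_bigr => i _; rewrite -mulrN -omegaC.
Qed.

Lemma omegavv p v : tangent p v -> omega p v v = 0.
Proof.
move=> tv; have /eqP := omegaC tv tv.
by rewrite -addr_eq0 -mulr2n mulrn_eq0 /= => /eqP.
Qed.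

Lemma omega_section p eta xi : section H eta -> section H xi ->
  omega p (eta p) (xi p) = - theta p (bracket eta xi p).
Proof.
move=> seta sxi; have [veta _] := seta; have [vxi _] := sxi; rewrite omegaE //.
rewrite /ext_d (ev_section seta) (ev_section sxi) /act.
by rewrite !(@tangent_cst _ _ _ p) // subr0 add0r.
Qed.

Lemma omega_nondegenerate p v : H p v -> (forall w, H p w -> omega p v w = 0) ->
  v = @vzero _ _ M.
Proof.
case: (HP) => _ _ nd /(dist_ext sH)[eta seta <-] v0; apply: nd => // xi sxi.
apply/coset_form_eqP.
- by apply: tangent_bracket; [case: seta|case: sxi].
- exact: tangent_vzero.
rewrite (form0 thetaP); apply/eqP; rewrite -oppr_eq0 -omega_section //.
by rewrite v0 //; case: sxi.
Qed.

(* The Reeb field is the case [h = 1], [alpha = 0]; the contact gradient of g is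
   the case [h = 0], [alpha = - dg]. *)
Lemma contact_sharp (h : M -> R) (alpha : rough_form M) :
  (forall p, smooth_near p h) ->
  (forall p k (c : 'I_k -> R) W, alpha p (vlin c W) = \sum_i c i * alpha p (W i)) ->
  (forall p X, vector_field X -> smooth_near p (ev alpha X)) ->
  exists2 V, vector_field V & forall p, theta p (V p) = h p /\
    forall w, H p w -> omega p (V p) w = alpha p w.
Proof.
move=> sh alin sa.
pose P q v := [/\ tangent q v, theta q v = h q &
  forall w, H q w -> omega q v w = alpha q w].
suff [V vV VP] : exists2 V, vector_field V & forall p, P p (V p).
  by exists V => // p; have [] := VP p.
apply: glue_vector_field => [q v w [tv hv av] [tw hw aw]|p].
  have tvw := tangent_vsub tv tw.
  have vw0 : vsub v w = @vzero _ _ M.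
    apply: (@omega_nondegenerate q).
      by apply/contact_formP; rewrite ?(formB thetaP) ?hv ?hw ?subrr.
    move=> u Hu; rewrite omegaB ?av ?aw ?subrr //; exact: dist_tangent Hu.
  apply/funext => f; apply/eqP; rewrite -subr_eq0.
  by rewrite -[_ - _]/(vsub v w f) vw0.
have [X [Z [sX vZ nXZ]]] := corank_one_frame sH cH p.
have vX i : vector_field (X i) by case: (sX i).
have tX q i : tangent q (X i q) by exact: vfield_tangent.
have HX q i : H q (X i q) by case: (sX i).
pose A q : 'M[R]_n.*2 := \matrix_(i, j) omega q (X i q) (X j q).
(* The solution is sought as c0 Z + sum_i c_i X_i. Since theta kills the X_i, the condition theta(V)
   = h determines c0; the conditions on omega(V, X_j) then form a linear system for the c_i with
   matrix A and right-hand side b. *)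
pose c0 q := h q * (theta q (Z q))^-1.
pose b q : 'rV[R]_n.*2 := \row_j (alpha q (X j q) - c0 q * omega q (Z q) (X j q)).
have nZ q : ~ H q (Z q) -> theta q (Z q) != 0.
  by move=> nHZ; apply: contra_notN nHZ => /eqP tZ; apply/contact_formP.
have sc0 : smooth_near p c0.
  apply: smooth_nearM => //; apply: smooth_nearV; first exact: (ev_smooth thetaP).
  by apply: nZ; case: (nbhs_singleton nXZ).
have som Y Y' : vector_field Y -> vector_field Y' ->
    smooth_near p (fun q => omega q (Y q) (Y' q)).
  move=> vY vY'; under eq_fun do rewrite omegaE //.
  exact: ext_d_smooth.
(* A row vector killed by A gives a vector of H orthogonal to the whole frame X, which is zero by
   nondegeneracy. *)
have dA : \det (A p) != 0.
  apply/negP => /det0P[c c0' cA]; case/negP: c0'; apply/eqP/rowP => i; rewrite mxE.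
  have [HXp free _ _] := nbhs_singleton nXZ.
  apply: (free (fun i => c 0 i)); apply: (@omega_nondegenerate p).
    exact: (dist_vlin sH).
  move=> w /HXp[d ->]; rewrite omega_vlinr //; last exact: tangent_vlin.
  apply: big1 => j _; rewrite omega_vlin //.
  have /rowP/(_ j) := cA; rewrite !mxE => cAj.
  by rewrite [X in _ * X](_ : _ = 0) ?mulr0 // -[RHS]cAj; apply: eq_bigr => l _; rewrite mxE.
have [||//|c [sc cE]] := @smooth_near_solve _ _ M p _ A b.
- by move=> i j; under eq_fun do rewrite mxE; exact: som.
- move=> j; under eq_fun do rewrite mxE; apply: smooth_nearB; first exact: (sa p (X j)).
  by apply: smooth_nearM => //; exact: som.
exists n.*2.+1, (frame_cons Z X), (fun q i => oapp (fun j => c q 0 j) (c0 q) (unlift ord0 i)).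
split; first exact: vfield_cons.
  by move=> i; case: (unliftP ord0 i) => [j|] _ /=; [exact: sc|exact: sc0].
apply: filterS2 nXZ cE => q [HXq _ /nZ nHZ _] [_ cA].
rewrite vlin_cons unlift_none /=.
rewrite (_ : (fun i => _) = (fun j => c q 0 j)); last by apply/funext => i; rewrite liftK.
have tZ : tangent q (Z q) by [].
have tcX : tangent q (vlin (fun j => c q 0 j) (X ^~ q)) by exact: tangent_vlin.
split; first by apply: tangent_vadd => //; exact: tangent_vscale.
  rewrite (formD thetaP) ?(formZ thetaP) //; last exact: tangent_vscale.
  by rewrite (contact_form_dist (dist_vlin sH _ (HX q))) addr0 /c0 mulfVK.
move=> w /HXq[d ->]; rewrite alin omega_vlinr //; last first.
  by apply: tangent_vadd => //; exact: tangent_vscale.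
apply: eq_bigr => j _; congr (_ * _).
rewrite omegaD ?omegaZ ?omega_vlin //; last exact: tangent_vscale.
have /rowP/(_ j) := cA; rewrite !mxE => cAj.
rewrite (_ : \sum_i _ = \sum_i c q 0 i * A q i j); last first.
  by apply: eq_bigr => i _; rewrite mxE.
by rewrite cAj addrCA subrr addr0.
Qed.

Lemma reebP : [/\ vector_field (reeb theta), forall p, theta p (reeb theta p) = 1 &
  forall p w, tangent p w -> omega p (reeb theta p) w = 0].
Proof.
have [|||r vr rP] := @contact_sharp (fun=> 1) (fun _ _ => 0).
- by move=> p; exact: smooth_near_cst.
- by move=> p k c W; rewrite big1 // => i _; rewrite mulr0.
- by move=> p X _; exact: smooth_near_cst.
have r1 p : theta p (r p) = 1 by case: (rP p).
have r0 p w : tangent p w -> omega p (r p) w = 0.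
  move=> tw; have tr : tangent p (r p) by [].
  (* [contact_sharp] controls omega(r, .) on H only. A general w is split as theta(w) r plus a
     vector of H, and the first part contributes omega(r, r) = 0. *)
  have trw : tangent p (vscale (theta p w) (r p)) by exact: tangent_vscale.
  rewrite -(vsubKC w (vscale (theta p w) (r p))) omegaDr //; last exact: tangent_vsub.
  rewrite omegaZr // omegavv // mulr0 add0r vsubE.
  have [_ -> //] := rP p.
  rewrite -vsubE; apply/contact_formP; first exact: tangent_vsub.
  by rewrite (formB thetaP) // (formZ thetaP) // r1 mulr1 subrr.
have [] : [set r | [/\ vector_field r, forall p, theta p (r p) = 1 &
        forall Y, vector_field Y -> forall p, ext_d theta r Y p = 0] ] (reeb theta).
  apply: (@xgetI _ _ _ r); split=> // Y vY p.
  by rewrite -omegaE // r0.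
move=> vreeb reeb1 reeb0; split=> // p w /(tangent_ext sH cH)[Y vY <-].
by rewrite omegaE // reeb0.
Qed.

End ContactForm.

(** * Legendrean contact structures *)

Section FrameConcatenation.
Variables (R : realType) (m : nat) (M : manifold R m).

Definition frame_cat k l (X : 'I_k -> rough_field M) (Y : 'I_l -> rough_field M)
    (i : 'I_(k + l)) : rough_field M :=
  match fintype.split i with inl j => X j | inr j => Y j end.

Lemma vlin_cat k l (c : 'I_(k + l) -> R) (X : 'I_k -> rough_field M)
    (Y : 'I_l -> rough_field M) q :
  vlin c (frame_cat X Y ^~ q) = vadd (vlin (fun i => c (lshift l i)) (X ^~ q))
                                     (vlin (fun j => c (rshift k j)) (Y ^~ q)).
Proof.
apply/funext => f; rewrite /vlin /vadd big_split_ord /=; congr (_ + _).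
  by apply: eq_bigr => i _; rewrite /frame_cat (unsplitK (inl i)).
by apply: eq_bigr => i _; rewrite /frame_cat (unsplitK (inr i)).
Qed.

End FrameConcatenation.

Section Legendrean.
Variables (R : realType) (n : nat) (M : manifold R n.*2.+1) (H E F : dist M).
Hypothesis HEF : legendrean_contact_structure H E F.
Implicit Types (p q : M) (v w e : vec M) (X Y Z V eta xi mu : rough_field M).

Let HP : contact_structure H. Proof. by case: HEF. Qed.
Let sH : subbundle n.*2 H. Proof. by case: HP. Qed.
Let sE : subbundle n E. Proof. by case: HEF => _ []. Qed.
Let sF : subbundle n F. Proof. by case: HEF => _ []. Qed.
Let EF0 p v : E p v -> F p v -> v = @vzero _ _ M.
Proof. by case: HEF => _ _ [_ h] _ _; exact: h. Qed.

Lemma subset_EH p v : E p v -> H p v.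
Proof.
move=> Ev; case: HEF => _ _ [h _] _ _; apply/h.
exists v, (@vzero _ _ M); split=> //; first exact: (dist_vzero sF).
by apply/funext => f; rewrite /vadd addr0.
Qed.

Lemma subset_FH p v : F p v -> H p v.
Proof.
move=> Fv; case: HEF => _ _ [h _] _ _; apply/h.
exists (@vzero _ _ M), v; split=> //; first exact: (dist_vzero sE).
by apply/funext => f; rewrite /vadd add0r.
Qed.

Lemma section_EH X : section E X -> section H X.
Proof. by move=> [vX EX]; split=> // p; exact: subset_EH. Qed.

Lemma section_FH X : section F X -> section H X.
Proof. by move=> [vX FX]; split=> // p; exact: subset_FH. Qed.

Lemma Ecomp_unique X p e : E p e -> F p (vsub (X p) e) -> Ecomp E F X p = e.
Proof.
move=> Ee Fe; apply: xget_unique => // e' [Ee' Fe'].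
have e0 : vsub e' e = @vzero _ _ M.
  apply: (@EF0 p); first exact: (dist_vsub sE).
  rewrite (_ : vsub e' e = vsub (vsub (X p) e) (vsub (X p) e')).
    exact: (dist_vsub sF).
  by apply/funext => f; rewrite /vsub; ring.
by rewrite -(vsubKC e' e) e0; apply/funext => f; rewrite /vadd addr0.
Qed.

(** Smoothness of the projection of H to E: local frames of E and F together are independent because
    E and F meet in zero, so X has smooth coefficients in them, and the E-component keeps the first
    n. *)
Lemma Ecomp_section X : section H X ->
  section E (Ecomp E F X) /\ section F (fsub X (Ecomp E F X)).
Proof.
move=> [vX HX]; pose P q v := E q v /\ F q (vsub (X q) v).
suff [V vV VP] : exists2 V, vector_field V & forall p, P p (V p).
  have -> : Ecomp E F X = V.
    by apply/funext => p; have [] := VP p; exact: Ecomp_unique.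
  by split; split=> [|p]; [|case: (VP p)|exact: vfield_fsub|case: (VP p)].
apply: glue_vector_field => [q v w [Ev Fv] [Ew Fw]|p].
  by rewrite -(Ecomp_unique Ev Fv) (Ecomp_unique Ew Fw).
have [e [se ne]] := sE p; have [f [sf nf]] := sF p.
have ve i : vector_field (e i) by case: (se i).
have vf i : vector_field (f i) by case: (sf i).
have vW i : vector_field (frame_cat e f i) by rewrite /frame_cat; case: fintype.split.
pose c q := xget (fun=> 0) [set c | X q = vlin c (frame_cat e f ^~ q)].
have cE : \forall q \near p, X q = vlin (c q) (frame_cat e f ^~ q).
  apply: filterS2 ne nf => q [Ee _] [Ff _].
  case: HEF => _ _ [h _] _ _; have /h[a [b [/Ee[ca ->] /Ff[cb ->] Xab]]] := HX q.
  pose d (i : 'I_(n + n)) := match fintype.split i with inl j => ca j | inr j => cb j end.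
  apply: (@xgetI _ (fun=> 0) [set c | X q = vlin c (frame_cat e f ^~ q)] d).
  rewrite /= vlin_cat Xab.
  have -> : (fun i => d (lshift n i)) = ca.
    by apply/funext => i; rewrite /d (unsplitK (inl i)).
  have -> // : (fun i => d (rshift n i)) = cb.
  by apply/funext => i; rewrite /d (unsplitK (inr i)).
have sc : forall i, smooth_near p (c ^~ i).
  apply: (@frame_coef_smooth _ _ _ p _ c (frame_cat e f) X) => // [d|g sg]; last exact: vfield_smooth.
  have [_ freee] := nbhs_singleton ne; have [_ freef] := nbhs_singleton nf.
  rewrite vlin_cat; set a := vlin _ _; set b := vlin _ _ => ab0.
  have Ea : E p a by apply: (dist_vlin sE) => i; case: (se i).
  have Fb : F p b by apply: (dist_vlin sF) => i; case: (sf i).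
  have abE : a = vscale (-1) b.
    apply/funext => g; have /(congr1 (fun v => v g)) := ab0.
    by rewrite /vadd /vscale mulN1r => /eqP; rewrite addr_eq0 => /eqP.
  have a0 : a = @vzero _ _ M.
    by apply: (EF0 Ea); rewrite abE; exact: (dist_vscale sF).
  have b0 : b = @vzero _ _ M.
    by rewrite -ab0 a0; apply/funext => g; rewrite /vadd add0r.
  move=> i; case: (splitP i) => j ij.
    by rewrite (_ : i = lshift n j); [exact: (freee _ a0)|exact: val_inj].
  by rewrite (_ : i = rshift n j); [exact: (freef _ b0)|exact: val_inj].
exists n, e, (fun q i => c q (lshift n i)); split=> //.
apply: filterS3 ne nf cE => q _ _ XE; split.
  by apply: (dist_vlin sE) => i; case: (se i).
rewrite XE vlin_cat (_ : vsub _ _ = vlin (fun j => c q (rshift n j)) (f ^~ q)).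
  by apply: (dist_vlin sF) => i; case: (sf i).
by apply/funext => g; rewrite /vsub /vadd; ring.
Qed.

Lemma coset_E_inj X Y : section E X -> section E Y -> coset F X = coset F Y -> X = Y.
Proof.
move=> [_ EX] [_ EY] XY; apply/funext => p.
have XY0 : vsub (X p) (Y p) = @vzero _ _ M.
  apply: (@EF0 p); first exact: (dist_vsub sE).
  by apply/(coset_eqP sF); rewrite XY.
rewrite -(vsubKC (X p) (Y p)) XY0.
by apply/funext => f; rewrite /vadd addr0.
Qed.

Lemma Elift_coset X : section E X -> Elift E F (coset F X) = X.
Proof.
move=> sX; apply: xget_unique; first by split.
by move=> Y [sY YX]; exact: coset_E_inj.
Qed.

Lemma piQ_coset X : piQ H (coset F X) = coset H X.
Proof.
apply/funext => p; apply/esym/(coset_eqP sH).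
by apply: subset_FH; exact: (rep_coset sF).
Qed.

(** * The form d theta on E and F, the splitting of TM/F, and the Levi bracket *)

Section WithContactForm.
Variable theta : rough_form M.
Hypothesis thetaH : contact_form H theta.

Let thetaP : one_form theta. Proof. by case: thetaH. Qed.
Let om := omega theta.
Let r := reeb theta.
Let vr : vector_field r. Proof. by case: (reebP HP thetaH). Qed.
Let r1 p : theta p (r p) = 1. Proof. by case: (reebP HP thetaH). Qed.
Let r0 p w : tangent p w -> om p (r p) w = 0.
Proof. by case: (reebP HP thetaH) => _ _; exact. Qed.
Let tE p v : E p v -> tangent p v. Proof. exact: (dist_tangent sE). Qed.
Let tF p v : F p v -> tangent p v. Proof. exact: (dist_tangent sF). Qed.

Lemma omega_levi0 eta xi p : section H eta -> section H xi ->
  levi H eta xi = qzero H -> om p (eta p) (xi p) = 0.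
Proof.
move=> seta sxi l0; rewrite /om (omega_section HP thetaH) //.
have [veta _] := seta; have [vxi _] := sxi.
suff -> : theta p (bracket eta xi p) = theta p (@vzero _ _ M).
  by rewrite (form0 thetaP) oppr0.
apply/(@coset_form_eqP _ _ _ _ HP _ thetaH p (bracket eta xi) (fun=> @vzero _ _ M)).
- exact: tangent_bracket.
- exact: tangent_vzero.
- exact: (congr1 (fun t => t p) l0).
Qed.

Lemma omega_EE p v w : E p v -> E p w -> om p v w = 0.
Proof.
move=> /(dist_ext sE)[X sX <-] /(dist_ext sE)[Y sY <-].
by apply: omega_levi0; [exact: section_EH..|case: HEF => _ _ _ h _; exact: h].
Qed.

Lemma omega_FF p v w : F p v -> F p w -> om p v w = 0.
Proof.
move=> /(dist_ext sF)[X sX <-] /(dist_ext sF)[Y sY <-].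
by apply: omega_levi0; [exact: section_FH..|case: HEF => _ _ _ _ h; exact: h].
Qed.

(** E is isotropic, so pairing with H reduces to pairing with F. This is the injectivity of the map
    from E to F^* (x) Q, on which the uniqueness of [sharp] rests. *)
Lemma omega_E_nondegenerate p v : E p v -> (forall w, F p w -> om p v w = 0) ->
  v = @vzero _ _ M.
Proof.
move=> Ev v0; apply: (@omega_nondegenerate _ _ _ _ HP _ thetaH p); first exact: subset_EH.
move=> w Hw; case: HEF => _ _ [h _] _ _; have /h[a [b [Ea Fb ->]]] := Hw.
rewrite (omegaDr HP thetaH); [|exact: tE|exact: tE|exact: tF].
by rewrite [X in X + _](omega_EE Ev Ea) [X in _ + X](v0 _ Fb) addr0.
Qed.

(** X differs from its E-component by a section of F, and F is isotropic. *)
Lemma omega_Ecomp X p w : section H X -> F p w ->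
  om p (Ecomp E F X p) w = om p (X p) w.
Proof.
move=> sX Fw; have [[_ EX] [_ FX]] := Ecomp_section sX.
rewrite -[in RHS](vsubKC (X p) (Ecomp E F X p)) /om (omegaD HP thetaH).
- by rewrite [X in _ + X](omega_FF (FX p) Fw) addr0.
- exact: tE.
- exact: tF (FX p).
- exact: tF.
Qed.

Lemma horizontal_section X : vector_field X -> section H (horizontal theta X).
Proof.
move=> vX; have vf : vector_field (horizontal theta X).
  by apply/vfield_fsub/vfield_fscale => // p; exact: (ev_smooth thetaP).
split=> // p; apply/(contact_formP thetaH) => //.
have tr : tangent p (fscale (ev theta X) r p) by exact: tangent_vscale.
by rewrite (formB thetaP) // (formZ thetaP) // r1 mulr1 subrr.
Qed.

Lemma omega_horizontal X p w : vector_field X -> tangent p w ->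
  om p (horizontal theta X p) w = om p (X p) w.
Proof.
move=> vX tw; rewrite /om (omegaB HP thetaH) //; last exact: tangent_vscale.
by rewrite (omegaZ HP thetaH) // (r0 tw : omega theta p (reeb theta p) w = 0) mulr0 subr0.
Qed.

(** The splitting is defined on a possibly rough representative. Exchanging it for X leaves theta
    unchanged and alters the horizontal part by a vector of F, which [Ecomp] ignores. *)
Lemma split_coset X : vector_field X ->
  Defs.split H E F theta (coset F X) = (coset H X, Ecomp E F (horizontal theta X)).
Proof.
move=> vX; rewrite /Defs.split piQ_coset; congr pair; apply/funext => p.
have [[_ EX] [_ FX]] := Ecomp_section (horizontal_section vX).
apply: Ecomp_unique => //.
have Frep := rep_coset sF p X.
have trep : tangent p (rep (coset F X) p) by apply: (tangent_rep sF); exact: vfield_tangent.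
have evE : ev theta (rep (coset F X)) p = ev theta X p.
  apply/eqP; rewrite eq_sym -subr_eq0 /ev -(formB thetaP) //.
  by rewrite (contact_form_dist HP thetaH) //; exact: subset_FH.
rewrite (_ : vsub _ _ = vsub (vsub (horizontal theta X p) (Ecomp E F (horizontal theta X) p))
                             (vsub (X p) (rep (coset F X) p))).
  by apply: (dist_vsub sF).
apply/funext => f; rewrite /horizontal /fsub /vsub /fscale /vscale evE.
by ring.
Qed.

(** The inverse of the splitting: a class in TM/F is rebuilt from its two components. *)
Lemma coset_splitting X : vector_field X ->
  coset F X = coset F (fadd (fscale (ev theta X) r) (Ecomp E F (horizontal theta X))).
Proof.
move=> vX; apply/funext => p; apply/(coset_eqP sF).
have [_ [_ FX]] := Ecomp_section (horizontal_section vX).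
rewrite (_ : vsub _ _ = fsub (horizontal theta X) (Ecomp E F (horizontal theta X)) p) //.
by apply/funext => f; rewrite /horizontal /fsub /fadd /vsub /vadd /fscale /vscale /r; ring.
Qed.

Lemma form_bracket eta xi p : section H eta -> section H xi ->
  theta p (bracket eta xi p) = - om p (eta p) (xi p).
Proof. by move=> *; rewrite /om (omega_section HP thetaH) // opprK. Qed.

Lemma levi_fadd eta eta' xi : section H eta -> section H eta' -> section H xi ->
  levi H (fadd eta eta') xi = qadd H (levi H eta xi) (levi H eta' xi).
Proof.
move=> s s' sxi; have [v Hv] := s; have [v' Hv'] := s'; have [vxi Hxi] := sxi.
have sD := section_fadd sH s s'; have [vD _] := sD.
have tb X : vector_field X -> forall p, tangent p (bracket X xi p).
  by move=> vX p; exact: tangent_bracket.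
rewrite /levi (qadd_coset sH); apply: (coset_form_eq HP thetaH).
- exact: tb.
- by move=> p; apply: tangent_vadd; exact: tb.
apply/funext => p; rewrite /ev (formD thetaP); [|exact: tb..].
rewrite !form_bracket // -opprD; congr (- _).
exact: (omegaD HP thetaH).
Qed.

Lemma levi_fscale f eta xi : (forall p, smooth_near p f) -> section H eta ->
  section H xi -> levi H (fscale f eta) xi = qscale H f (levi H eta xi).
Proof.
move=> sf s sxi; have [v Hv] := s; have [vxi Hxi] := sxi.
have sD := section_fscale sH sf s; have [vD _] := sD.
have tb X : vector_field X -> forall p, tangent p (bracket X xi p).
  by move=> vX p; exact: tangent_bracket.
rewrite /levi (qscale_coset sH); apply: (coset_form_eq HP thetaH).
- exact: tb.
- by move=> p; apply: tangent_vscale; exact: tb.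
apply/funext => p; rewrite /ev (formZ thetaP); last exact: tb.
rewrite !form_bracket // mulrN; congr (- _).
exact: (omegaZ HP thetaH).
Qed.

Lemma levi_faddr eta xi xi' : section H eta -> section H xi -> section H xi' ->
  levi H eta (fadd xi xi') = qadd H (levi H eta xi) (levi H eta xi').
Proof.
move=> s sxi sxi'; have [v _] := s; have [vxi _] := sxi; have [vxi' _] := sxi'.
have sD := section_fadd sH sxi sxi'; have [vD _] := sD.
have tb X : vector_field X -> forall p, tangent p (bracket eta X p).
  by move=> vX p; exact: tangent_bracket.
rewrite /levi (qadd_coset sH); apply: (coset_form_eq HP thetaH).
- exact: tb.
- by move=> p; apply: tangent_vadd; exact: tb.
apply/funext => p; rewrite /ev (formD thetaP); [|exact: tb..].
rewrite !form_bracket // -opprD; congr (- _).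
exact: (omegaDr HP thetaH).
Qed.

Lemma levi_fscaler f eta xi : (forall p, smooth_near p f) -> section H eta ->
  section H xi -> levi H eta (fscale f xi) = qscale H f (levi H eta xi).
Proof.
move=> sf s sxi; have [v _] := s; have [vxi _] := sxi.
have sD := section_fscale sH sf sxi; have [vD _] := sD.
have tb X : vector_field X -> forall p, tangent p (bracket eta X p).
  by move=> vX p; exact: tangent_bracket.
rewrite /levi (qscale_coset sH); apply: (coset_form_eq HP thetaH).
- exact: tb.
- by move=> p; apply: tangent_vscale; exact: tb.
apply/funext => p; rewrite /ev (formZ thetaP); last exact: tb.
rewrite !form_bracket // mulrN; congr (- _).
exact: (omegaZr HP thetaH).
Qed.

Lemma sharp_unique psi (e : rough_field M) : section E e ->
  (forall xi, section F xi -> levi H e xi = psi xi) -> sharp H E F psi = e.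
Proof.
move=> se eP; apply: xget_unique; first by split.
move=> e' [se' e'P]; apply/funext => p.
have [ve Ee] := se; have [ve' Ee'] := se'.
have ee0 : vsub (e' p) (e p) = @vzero _ _ M.
  apply: (@omega_E_nondegenerate p); first exact: (dist_vsub sE).
  move=> w /(dist_ext sF)[xi sxi <-]; have [vxi _] := sxi.
  rewrite /om (omegaB HP thetaH) //; apply/eqP; rewrite subr_eq0 -eqr_opp; apply/eqP.
  rewrite -!form_bracket //; try exact: section_EH; try exact: section_FH.
  apply/(coset_form_eqP HP thetaH); try exact: tangent_bracket.
  by have := e'P xi sxi; rewrite -(eP xi sxi) => /(congr1 (fun t => t p)).
rewrite -(vsubKC (e' p) (e p)) ee0.
by apply/funext => f; rewrite /vadd addr0.
Qed.

(** Projecting the contact gradient to E does not change its pairing with F. The sign is forced by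
    theta([e, xi]) = - omega(e, xi), which has to equal xi . g. *)
Lemma exists_gradient (g : M -> R) : (forall p, smooth_near p g) ->
  exists2 e, section E e & forall p w, F p w -> om p (e p) w = - w g.
Proof.
move=> sg; have [|||V vV VP] := @contact_sharp _ _ _ _ HP _ thetaH
    (fun=> 0) (fun _ v => - v g).
- by move=> p; exact: smooth_near_cst.
- by move=> p k c W; rewrite /vlin -sumrN; apply: eq_bigr => i _; rewrite mulrN.
- move=> p X vX; rewrite /ev; under eq_fun do rewrite -mulN1r.
  by apply: smooth_nearZ; exact: (vfield_smooth vX (sg p)).
have sV : section H V.
  by split=> // p; apply/(contact_formP thetaH) => //; case: (VP p).
have [sEV _] := Ecomp_section sV.
exists (Ecomp E F V) => // p w Fw; rewrite omega_Ecomp //.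
by case: (VP p) => _; apply; exact: subset_FH.
Qed.

Lemma nablaQE xi rho : nablaQ H theta xi rho = coset H (fscale (act xi (qev theta rho)) r).
Proof. by rewrite /nablaQ (qscale_coset sH). Qed.

Lemma qev_smooth rho : qsection H rho -> smooth (qev theta rho).
Proof.
move=> [X vX ->]; rewrite (qev_coset HP thetaH); last by move=> p; exact: vfield_tangent.
by case: thetaP => _ _; exact.
Qed.

(** Isotropy of F keeps the bracket in H, so that its E-component, the torsion of F, is a genuine
    section of E. *)
Lemma bracket_FF_section xi1 xi2 : section F xi1 -> section F xi2 ->
  section H (bracket xi1 xi2).
Proof.
move=> s1 s2; have [v1 F1] := s1; have [v2 F2] := s2.
have vb := vfield_bracket v1 v2; split=> // q; apply/(contact_formP thetaH) => //.
by rewrite form_bracket ?omega_FF ?oppr0 //; exact: section_FH.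
Qed.

(** * The section Phi of a contact form and its skew part *)

Section Operator.
Variable rho : qfield M.
Hypothesis rhoP : qsection H rho.
Let g := qev theta rho.
Let sg p : smooth_near p g. Proof. exact/smoothP/qev_smooth. Qed.
Let mu := sharp H E F (fun xi => nablaQ H theta xi rho).

Lemma sharp_nablaQ : section E mu /\ forall p w, F p w -> om p (mu p) w = - w g.
Proof.
have [e se eP] := exists_gradient sg.
suff -> : mu = e by [].
apply: sharp_unique => // xi sxi; have [ve _] := se; have [vxi Fxi] := sxi.
rewrite nablaQE; apply: (coset_form_eq HP thetaH).
- by move=> p; exact: tangent_bracket.
- by move=> p; exact: tangent_vscale.
apply/funext => p; rewrite /ev (formZ thetaP) // r1 mulr1.
rewrite form_bracket; [|exact: section_EH|exact: section_FH].
by rewrite eP // opprK.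
Qed.

Lemma bracket_reeb_section xi : section F xi -> section H (bracket xi r).
Proof.
move=> sxi; have [vxi _] := sxi; have vb := vfield_bracket vxi vr.
split=> // p; apply/(contact_formP thetaH) => //.
have : ext_d theta xi r p = 0.
  rewrite -(omegaE HP thetaH) // (omegaC HP thetaH) // [omega _ _ _ _]r0 //.
  by rewrite oppr0.
rewrite /ext_d (ev_section HP thetaH (section_FH sxi)) /act.
rewrite (_ : ev theta r = fun=> 1); last by apply/funext => q; exact: r1.
by rewrite !(@tangent_cst _ _ _ p) // subrr sub0r => /eqP; rewrite oppr_eq0 => /eqP.
Qed.

Lemma nablaE_section xi eta : section F xi -> section E eta ->
  section E (nablaE E F theta xi eta).
Proof.
move=> [vxi _] [veta _].
by case: (Ecomp_section (horizontal_section (vfield_bracket vxi veta))).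
Qed.

Lemma Ptensor_section xi : section F xi -> section E (Ptensor E F theta xi).
Proof. by move=> /bracket_reeb_section /Ecomp_section[]. Qed.

(** Phi(xi) of the overview, built from theta without reference to a partial connection on TM/F, so
    that its symmetry can be studied separately. *)
Definition BGG_phi xi : rough_field M :=
  fadd (nablaE_nablaQ H E F theta rho xi) (fscale g (Ptensor E F theta xi)).

Lemma BGG_phi_section xi : section F xi -> section E (BGG_phi xi).
Proof.
move=> sxi; apply: (section_fadd sE).
  by apply: nablaE_section => //; case: sharp_nablaQ.
by apply: (section_fscale sE) => //; exact: Ptensor_section.
Qed.

(** Against F, the projections to E and the horizontal correction along r are invisible, leaving
    plain brackets to which the closedness of d theta applies. *)
Lemma omega_BGG_phi xi p w : section F xi -> F p w ->
  om p (BGG_phi xi p) w = om p (bracket xi mu p) w + g p * om p (bracket xi r p) w.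
Proof.
move=> sxi Fw; have [smu _] := sharp_nablaQ; have [vmu _] := smu; have [vxi _] := sxi.
have vb := vfield_bracket vxi vmu.
have [vN _] := nablaE_section sxi smu; have [vP _] := Ptensor_section sxi.
have tw := tF Fw.
rewrite /om (omegaD HP thetaH) //; last exact: tangent_vscale.
rewrite (omegaZ HP thetaH) //.
congr (_ + _ * _).
  rewrite [LHS](omega_Ecomp (horizontal_section vb) Fw).
  exact: omega_horizontal.
exact: (omega_Ecomp (bracket_reeb_section sxi) Fw).
Qed.

(* The obstruction to symmetry is the torsion [(xi1, xi2) |-> [xi1, xi2]_E] of
   the possibly non-involutive bundle F; both parts come from [d (d theta) = 0],
   evaluated on (xi1, xi2, mu) and on (xi1, xi2, r). *)
Lemma BGG_phi_skew xi1 xi2 p : section F xi1 -> section F xi2 ->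
  theta p (bracket (BGG_phi xi1) xi2 p) - theta p (bracket (BGG_phi xi2) xi1 p) =
  Ecomp E F (bracket xi1 xi2) p g.
Proof.
move=> s1 s2; have [smu muP] := sharp_nablaQ.
have [v1 F1] := s1; have [v2 F2] := s2; have [vmu Emu] := smu.
have H1 := section_FH s1; have H2 := section_FH s2.
have v12 := vfield_bracket v1 v2.
rewrite !form_bracket //; try by apply: section_EH; exact: BGG_phi_section.
rewrite !omega_BGG_phi //.
have s12 := bracket_FF_section s1 s2.
have [[vT ET] [vT' FT]] := Ecomp_section s12.
have dE X Y q : vector_field X -> vector_field Y -> ext_d theta X Y q = om q (X q) (Y q).
  by move=> vX vY; rewrite /om (omegaE HP thetaH).
have d12 : ext_d theta xi1 xi2 = fun=> 0.
  by apply/funext => q; rewrite dE // omega_FF.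
have d2r : ext_d theta xi2 r = fun=> 0.
  by apply/funext => q; rewrite dE // /om (omegaC HP thetaH) // [omega _ _ _ _]r0 ?oppr0.
have dr1 : ext_d theta r xi1 = fun=> 0.
  by apply/funext => q; rewrite dE // r0.
have d2mu : ext_d theta xi2 mu = act xi2 g.
  by apply/funext => q; rewrite dE // /om (omegaC HP thetaH) // [omega _ _ _ _]muP ?opprK.
have dmu1 : ext_d theta mu xi1 = fun q => 0 - act xi1 g q.
  by apply/funext => q; rewrite dE // muP // sub0r.
(* On (xi1, xi2, r) all three derivative terms vanish and r annihilates [xi1, xi2], so P is
   symmetric whatever the torsion. *)
have Rp : om p (bracket xi1 r p) (xi2 p) = om p (bracket xi2 r p) (xi1 p).
  have := ext_d_closed thetaP p v1 v2 vr.
  rewrite d12 d2r dr1 /act !(@tangent_cst _ _ _ p) // !dE //; try exact: vfield_bracket.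
  have -> : om p (bracket xi1 xi2 p) (r p) = 0.
    by rewrite /om (omegaC HP thetaH) // [omega _ _ _ _]r0 ?oppr0.
  rewrite !add0r (bracketC xi1 r) /om (omegaZ HP thetaH) //; last exact: tangent_bracket.
  by rewrite mulN1r => /eqP; rewrite eq_sym subr_eq0 => /eqP.
have Mp := ext_d_closed thetaP p v1 v2 vmu.
move: Mp; rewrite d12 d2mu dmu1 /act !dE //; try exact: vfield_bracket.
rewrite (tangentB (vfield_tangent p v2) (smooth_near_cst p 0) (vfield_smooth v1 (sg p))).
rewrite !(@tangent_cst _ _ _ p) // sub0r addr0.
(* The torsion enters here: mu is orthogonal to the E-part of [xi1, xi2], and pairing the F-part
   with mu gives its derivative of g. The missing E-part is the defect. *)
have -> : om p (bracket xi1 xi2 p) (mu p) = bracket xi1 xi2 p g - Ecomp E F (bracket xi1 xi2) p g.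
  rewrite -{1}(vsubKC (bracket xi1 xi2 p) (Ecomp E F (bracket xi1 xi2) p)).
  rewrite /om (omegaD HP thetaH); [|exact: tE|exact: tF (FT p)|exact: tE].
  rewrite [X in X + _](omega_EE (ET p) (Emu p)) add0r.
  rewrite (omegaC HP thetaH); [|exact: tE|exact: tF (FT p)].
  by rewrite [X in - X](muP _ _ (FT p)) opprK.
rewrite bracketE // (bracketC xi1 mu) /om (omegaZ HP thetaH) //; last exact: tangent_bracket.
rewrite -/om Rp /act => Mp.
apply/eqP; rewrite -subr_eq0; apply/eqP; move/eqP: Mp; rewrite eq_sym -subr_eq0 => /eqP <-.
by ring.
Qed.

End Operator.

(** * The operators S and D of the partial connection, computed with one contact form *)

Section BGG.
Variable nab : rough_field M -> qfield M -> qfield M.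
Hypothesis Hnab : is_nablaTMF H E F nab.

Let nab_qsection xi X : section F xi -> vector_field X ->
  qsection F (nab xi (coset F X)).
Proof. by case: Hnab => -[h _ _ _ _] _ sxi vX; apply: h => //; exists X. Qed.

Let nab_split xi X : section F xi -> vector_field X ->
  Defs.split H E F theta (nab xi (coset F X)) =
  (qadd H (nablaQ H theta xi (coset H X)) (levi H xi (Ecomp E F (horizontal theta X))),
   fadd (nablaE E F theta xi (Ecomp E F (horizontal theta X)))
        (fscale (ev theta X) (Ecomp E F (bracket xi r)))).
Proof.
case: Hnab => _ h sxi vX.
have := h theta thetaH xi (coset F X) sxi (ex_intro2 _ _ X vX erefl).
cbv zeta; by rewrite (split_coset vX) /= (qev_coset HP thetaH).
Qed.

(** As L(xi, e) = - L(e, xi), the Q-component of the derivative of t along xi is the Levi bracket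
    with xi of a difference: the section dual to nabla^Q pi_Q(t) minus the E-component of t. Its
    vanishing singles out S. *)
Lemma del_star_coset X : vector_field X ->
  del_star H E F (nab ^~ (coset F X)) =
  coset F (fsub (sharp H E F (fun xi => nablaQ H theta xi (coset H X)))
                (Ecomp E F (horizontal theta X))).
Proof.
move=> vX; rewrite /del_star.
have qX : qsection H (coset H X) by exists X.
have [sm mP] := sharp_nablaQ qX; have [smu _] := Ecomp_section (horizontal_section vX).
have [vm Em] := sm; have [vmu Emu] := smu.
congr coset; apply: sharp_unique; first exact: (section_fsub sE).
move=> xi sxi; have [vxi Fxi] := sxi.
have -> : piQ H (nab xi (coset F X)) = (Defs.split H E F theta (nab xi (coset F X))).1 by [].
rewrite nab_split //= nablaQE /levi (qadd_coset sH).
have vS := vfield_fsub vm vmu.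
have tr p : tangent p (fscale (act xi (qev theta (coset H X))) r p) by exact: tangent_vscale.
have tb p : tangent p (bracket xi (Ecomp E F (horizontal theta X)) p) by exact: tangent_bracket.
apply: (coset_form_eq HP thetaH).
- by move=> p; exact: tangent_bracket.
- by move=> p; exact: tangent_vadd.
apply/funext => p; rewrite /ev (formD thetaP) // (formZ thetaP) // r1 mulr1.
rewrite !form_bracket; try exact: section_FH; try exact: section_EH.
  rewrite /om (omegaB HP thetaH) // [X in - (X - _)](mP _ _ (Fxi p)).
  by rewrite [X in _ = _ - X](omegaC HP thetaH) // /act; ring.
by apply: section_EH; exact: (section_fsub sE).
Qed.

Section Rho.
Variable rho : qfield M.
Hypothesis rhoP : qsection H rho.
Let g := qev theta rho.
Let mu := sharp H E F (fun xi => nablaQ H theta xi rho).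
Let sg p : smooth_near p g. Proof. exact/smoothP/qev_smooth. Qed.

Let S0 := fadd (fscale g r) mu.

Let vS0 : vector_field S0.
Proof.
by apply: vfield_fadd; [exact: vfield_fscale|case: (sharp_nablaQ rhoP) => -[]].
Qed.

Let evS0 : ev theta S0 = g.
Proof.
have [[vmu Emu] _] := sharp_nablaQ rhoP.
apply/funext => p; rewrite /ev (formD thetaP) //; last exact: tangent_vscale.
rewrite (formZ thetaP) // r1 mulr1 (contact_form_dist HP thetaH) ?addr0 //.
exact: subset_EH.
Qed.

Let horS0 : Ecomp E F (horizontal theta S0) = mu.
Proof.
have [[_ Emu] _] := sharp_nablaQ rhoP.
apply/funext => p; apply: Ecomp_unique; first exact: Emu.
rewrite (_ : vsub _ _ = @vzero _ _ M); first exact: (dist_vzero sF).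
apply/funext => f; rewrite /horizontal evS0 /S0 -/r.
by rewrite /fsub /fadd /fscale /vsub /vadd /vscale /vzero; ring.
Qed.

Let cosetS0 : coset H S0 = rho.
Proof.
have [X vX rhoE] := rhoP; rewrite rhoE; apply: (coset_form_eq HP thetaH).
- by move=> p; exact: vfield_tangent.
- by move=> p; exact: vfield_tangent.
rewrite evS0 /g rhoE (qev_coset HP thetaH) // => p; exact: vfield_tangent.
Qed.

Lemma BGG_SE : BGG_S H E F nab rho = coset F (fadd (fscale g r) mu).
Proof.
apply: xget_unique => [|s [[X vX ->]]].
  split; first by exists S0.
    by rewrite piQ_coset cosetS0.
  rewrite del_star_coset // cosetS0 horS0; congr coset.
  by apply/funext => p; exact: vsubvv.
rewrite piQ_coset del_star_coset // => Xrho; rewrite Xrho -/mu => muX.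
have [smu _] := sharp_nablaQ rhoP; have [sXE _] := Ecomp_section (horizontal_section vX).
rewrite coset_splitting // -(qev_coset HP thetaH) ?Xrho -/g; last first.
  by move=> p; exact: vfield_tangent.
congr (coset F (fadd _ _)); apply: coset_E_inj => //.
apply/funext => p; apply/esym/(coset_eqP sF).
have /(coset_eqP sF) := congr1 (fun t => t p) muX.
by rewrite (_ : vsub _ _ = vsub (mu p) (Ecomp E F (horizontal theta X) p)) //;
  apply/funext => f; rewrite /fsub /vsub /vzero subr0.
Qed.

Lemma nab_BGG_S xi : section F xi ->
  nab xi (BGG_S H E F nab rho) = coset F (BGG_phi rho xi).
Proof.
move=> sxi; have [vxi Fxi] := sxi; rewrite BGG_SE -/S0.
have [[vmu Emu] muP] := sharp_nablaQ rhoP.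
have [X vX XE] := nab_qsection sxi vS0.
have := nab_split sxi vS0.
rewrite XE split_coset // cosetS0 horS0 evS0 nablaQE -/g /levi (qadd_coset sH).
case=> X1 X2; rewrite coset_splitting //; congr coset.
(* The Q-component is xi . g + theta([xi, mu]), and the defining property of mu makes the two terms
   opposite; hence the derivative of S(rho) lies in E. *)
suff -> : ev theta X = fun=> 0.
  rewrite X2; apply/funext => p; apply/funext => f.
  by rewrite /fadd /vadd /fscale /vscale mul0r add0r.
have tr p : tangent p (fscale (act xi g) r p) by exact: tangent_vscale.
have tb p : tangent p (bracket xi mu p) by exact: tangent_bracket.
apply/funext => p; have /(coset_form_eqP HP thetaH) := congr1 (fun t => t p) X1.
rewrite /ev => -> //; last exact: tangent_vadd.
rewrite (formD thetaP) // (formZ thetaP) // r1 mulr1.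
rewrite form_bracket; [|exact: section_FH|by apply: section_EH].
by rewrite /om (omegaC HP thetaH) // opprK [X in _ + X](muP _ _ (Fxi p)) subrr.
Qed.

Lemma BGG_DE xi1 xi2 : section F xi1 ->
  BGG_D H E F nab rho xi1 xi2 = levi H (BGG_phi rho xi1) xi2.
Proof.
move=> s1; rewrite /BGG_D /flat nab_BGG_S // Elift_coset //.
exact: BGG_phi_section.
Qed.

Lemma BGG_D_formula xi1 xi2 : section F xi1 -> section F xi2 ->
  BGG_D H E F nab rho xi1 xi2 =
  qadd H (flat H (nablaE_nablaQ H E F theta rho) xi1 xi2)
         (qscale H g (flat H (Ptensor E F theta) xi1 xi2)).
Proof.
move=> s1 s2; rewrite BGG_DE // /flat.
have sP := Ptensor_section s1.
have sN : section E (nablaE_nablaQ H E F theta rho xi1).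
  by apply: nablaE_section => //; case: (sharp_nablaQ rhoP).
rewrite levi_fadd; [|exact: section_EH| |exact: section_FH].
  by rewrite levi_fscale //; [exact: section_EH|exact: section_FH].
by apply/section_EH/(section_fscale sE).
Qed.

(** The left-hand side does not involve theta, while the right-hand side involves it only through g
    = theta(rho). Conditions for different contact forms and the same rho are therefore equivalent
    to each other. *)
Lemma BGG_D_symP xi1 xi2 p : section F xi1 -> section F xi2 ->
  BGG_D H E F nab rho xi1 xi2 p = BGG_D H E F nab rho xi2 xi1 p <->
  Ecomp E F (bracket xi1 xi2) p g = 0.
Proof.
move=> s1 s2; rewrite !BGG_DE // /levi.
have [v1 _] := BGG_phi_section rhoP s1; have [v2 _] := BGG_phi_section rhoP s2.
have [vxi1 _] := s1; have [vxi2 _] := s2.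
rewrite (coset_form_eqP HP thetaH) /g; try exact: tangent_bracket.
rewrite -(BGG_phi_skew rhoP p s1 s2).
by split=> [->|/eqP]; [rewrite subrr|rewrite subr_eq0 => /eqP].
Qed.

(** Linearity in xi1 is inherited from the axioms of a partial connection, through the injectivity
    of E into TM/F; linearity in xi2 is that of the Levi bracket on H. *)
Lemma BGG_D_FFQ : FFQ_section H F (BGG_D H E F nab rho).
Proof.
have phi_s xi : section F xi -> section H (BGG_phi rho xi).
  by move=> sxi; apply: section_EH; exact: BGG_phi_section.
have [X vX SX] : qsection F (BGG_S H E F nab rho) by exists S0 => //; exact: BGG_SE.
case: Hnab => -[_ nabD nabZ _ _] _.
split=> [xi1 xi2 s1 s2|xi1 xi1' xi2 s1 s1' s2|xi1 xi2 xi2' s1 s2 s2'|f xi1 xi2 sf s1 s2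
        |f xi1 xi2 sf s1 s2].
- rewrite BGG_DE //; exists (bracket (BGG_phi rho xi1) xi2) => //.
  by apply: vfield_bracket; [case: (phi_s _ s1)|case: s2].
- have sD := section_fadd sF s1 s1'.
  rewrite !BGG_DE // -levi_fadd; [|exact: phi_s..|exact: section_FH].
  congr levi; apply: coset_E_inj.
  + exact: BGG_phi_section.
  + by apply: (section_fadd sE); exact: BGG_phi_section.
  rewrite -(qadd_coset sF) -!nab_BGG_S // nabD //.
  by exists X.
- by rewrite !BGG_DE // levi_faddr; [|exact: phi_s|exact: section_FH..].
- have sf' p : smooth_near p f by exact: smoothP.
  have sZ := section_fscale sF sf' s1.
  rewrite !BGG_DE // -levi_fscale; [|exact: sf'|exact: phi_s|exact: section_FH].
  congr levi; apply: coset_E_inj.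
  + exact: BGG_phi_section.
  + by apply: (section_fscale sE) => //; exact: BGG_phi_section.
  rewrite -(qscale_coset sF) -!nab_BGG_S // nabZ //.
  by exists X.
- have sf' p : smooth_near p f by exact: smoothP.
  by rewrite !BGG_DE // levi_fscaler; [|exact: sf'|exact: phi_s|exact: section_FH].
Qed.

End Rho.

End BGG.

Lemma torsion_tangent p xi1 xi2 : section F xi1 -> section F xi2 ->
  tangent p (Ecomp E F (bracket xi1 xi2) p).
Proof.
by move=> s1 s2; have [[vT _] _] := Ecomp_section (bracket_FF_section s1 s2).
Qed.

End WithContactForm.

(** * Change of contact form and vanishing of the torsion on functions *)

Lemma contact_form_scale theta (h : M -> R) : contact_form H theta -> smooth h ->
  (forall p, h p != 0) -> contact_form H (fun p v => h p * theta p v).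
Proof.
move=> [[tD tZ tS] tH] sh h0; split; first split.
- by move=> p v w tv tw; rewrite tD // mulrDr.
- by move=> p a v tv; rewrite tZ // mulrCA.
- by move=> X vX; apply: smooth_onM => //; [exact: openT|exact: tS].
move=> p v tv; rewrite -tH //; split=> [/eqP|->]; last by rewrite mulr0.
by rewrite mulf_eq0 (negbTE (h0 p)) /= => /eqP.
Qed.

(* Rescaling theta by h changes theta(rho), but not the symmetry of D(rho):
   for rho the class of the Reeb field of theta, theta(rho) = 1 makes D(rho)
   symmetric, so the torsion [xi1, xi2]_E annihilates (h theta)(rho) = h. *)
Lemma torsion_nonvanishing_eq0 nab theta (h : M -> R) xi1 xi2 p :
  is_nablaTMF H E F nab -> contact_form H theta -> smooth h ->
  (forall q, h q != 0) -> section F xi1 -> section F xi2 ->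
  Ecomp E F (bracket xi1 xi2) p h = 0.
Proof.
move=> Hnab thetaH sh h0 s1 s2.
have [vr r1 _] := reebP HP thetaH.
have tr q : tangent q (reeb theta q) by exact: vfield_tangent.
have rhoP : qsection H (coset H (reeb theta)) by exists (reeb theta).
have htH := contact_form_scale thetaH sh h0.
have [_ T1] := BGG_D_symP thetaH Hnab rhoP p s1 s2.
have [Th _] := BGG_D_symP htH Hnab rhoP p s1 s2.
have := Th (T1 _); rewrite !(qev_coset HP) //.
have -> : ev (fun p v => h p * theta p v) (reeb theta) = h.
  by apply/funext => q; rewrite /ev r1 mulr1.
apply; rewrite (_ : ev _ _ = fun=> 1); last by apply/funext.
by apply: (@tangent_cst _ _ _ p); exact: (torsion_tangent thetaH p s1 s2).
Qed.

Lemma torsion_eq0 nab theta (g : M -> R) xi1 xi2 p :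
  is_nablaTMF H E F nab -> contact_form H theta -> smooth g ->
  section F xi1 -> section F xi2 -> Ecomp E F (bracket xi1 xi2) p g = 0.
Proof.
move=> Hnab thetaH sg s1 s2.
have tT := torsion_tangent thetaH p s1 s2.
(* The shift normalizes k(p) = 1, so that k^2 has differential 2 dg at p; without the added 1 it
   would be critical there. Squaring and adding 1 gives a function that is at least 1 for every
   g. *)
pose k q := g q + (1 - g p).
have sk : smooth k by apply: smooth_onD => //; [exact: openT|exact: smooth_on_cst].
have sk2 : smooth (fun q => k q * k q) by apply: smooth_onM => //; exact: openT.
have sh : smooth (fun q => 1 + k q * k q).
  by apply: smooth_onD => //; [exact: openT|exact: smooth_on_cst].
have := torsion_nonvanishing_eq0 p Hnab thetaH sh _ s1 s2.
have -> : Ecomp E F (bracket xi1 xi2) p (fun q => 1 + k q * k q) =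
    Ecomp E F (bracket xi1 xi2) p g *+ 2.
  rewrite (tangentD tT (smooth_near_cst p 1) (smoothP p sk2)) (tangent_cst _ tT) add0r.
  rewrite (tangentM tT (smoothP p sk) (smoothP p sk)).
  rewrite /k (tangentD tT (smoothP p sg) (smooth_near_cst p _)) (tangent_cst _ tT).
  by ring.
move=> h; apply/eqP; rewrite -[_ == 0](@mulrn_eq0 _ _ 2) h // => q.
by rewrite gt_eqF // ltr_pwDl // -expr2 sqr_ge0.
Qed.

End Legendrean.

Theorem theorem3p1 (R : realType) (n : nat) (M : manifold R n.*2.+1)
    (H E F : dist M) (nab : rough_field M -> qfield M -> qfield M)
    (HEF : legendrean_contact_structure H E F)
    (Hcontact : exists theta : rough_form M, contact_form H theta)
    (Hnab : is_nablaTMF H E F nab) :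
  (forall rho : qfield M, qsection H rho ->
     Sym2FQ_section H F (BGG_D H E F nab rho)) /\
  (forall (theta : rough_form M) (rho : qfield M),
     contact_form H theta -> qsection H rho ->
     forall xi1 xi2 : rough_field M, section F xi1 -> section F xi2 ->
       BGG_D H E F nab rho xi1 xi2 =
       qadd H (flat H (nablaE_nablaQ H E F theta rho) xi1 xi2)
              (qscale H (qev theta rho) (flat H (Ptensor E F theta) xi1 xi2))).
Proof.
split=> [rho rhoP|theta rho thetaH rhoP xi1 xi2 s1 s2]; last first.
  exact: (BGG_D_formula HEF thetaH Hnab rhoP).
(* Symmetry of D(rho) mentions no contact form, so any one may be fixed to test it. *)
have [theta thetaH] := Hcontact; split; first exact: (BGG_D_FFQ HEF thetaH Hnab rhoP).
move=> xi1 xi2 s1 s2; apply/funext => p.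
apply/(BGG_D_symP HEF thetaH Hnab rhoP p s1 s2).
by apply: (torsion_eq0 HEF p Hnab thetaH); first exact: (qev_smooth HEF thetaH).
Qed.
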